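(* Let $L(z)$ be a proper Laurent polynomial and let $M(z)$ be a Laurent polynomial with $M_\infty(0)=0$ such that $$\int_{S^1}L^i(z)\,dM(z)=0\qquad( * )$$ holds for all $i\ge i_0$, where $i_0\ge0$. Then $( * )$ holds for all $i\ge0$. Furthermore, for a Laurent polynomial $M$ with $M_\infty(0)=0$ the condition that $( * )$ holds for all $i\ge i_0$ is equivalent to the condition $$\sum_{i\in J_0}M_\infty\bigl(L_i^{-1}(t)\bigr)\equiv\sum_{i\in J_\infty}M_0\bigl(L_i^{-1}(t)\bigr)$$ (identity for $t$ near infinity). Finally, if the monodromy group of $L$ is doubly transitive, or more generally, if $E_{\mathbb Q}$ and $E_{\mathbb Q}^\perp$ are the only invariant subspaces (other than $0$ and the whole space) with respect to the permutation matrix representation over $\mathbb Q$ of the monodromy group $G_L$ of $L$, then $( * )$ holds for all $i\ge i_0$ if and only if $M(z)=\tilde M(L(z))$, where $\tilde M$ is a polynomial.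
   Context: Laurent polynomials are elements of $\mathbb C[z,z^{-1}]$. $L$ is proper if it is neither a polynomial in $z$ nor a polynomial in $1/z$. $S^1$ is the unit circle. For a Laurent polynomial $M$, $M_0$ denotes the principal part of $M$ at $0$ (the sum of the terms with negative exponents), and $M_\infty=M-M_0$. Let $r=\deg L$ be the degree of $L$ as a rational function. Let $U\subset\mathbb C$ be a simply connected domain containing no branch points of $L^{-1}$ with $\infty\in\partial U$, and let $L_1^{-1},\dots,L_r^{-1}$ be the single-valued branches of the algebraic function $L^{-1}$ in $U$. $J_0$ (resp. $J_\infty$) is the set of $i\in\{1,\dots,r\}$ such that for $t\in U$ close to infinity $L_i^{-1}(t)$ is close to $0$ (resp. to $\infty$); so for $|t|$ large the sums over $J_0$ and $J_\infty$ are the sums over those solutions $x$ of $L(x)=t$ lying near $0$, respectively near $\infty$, and $J_0\cup J_\infty=\{1,\dots,r\}$. The monodromy group $G_L\subset S_r$ is the group of permutations of the branches of $L^{-1}$ induced by analytic continuation along loops avoiding the branch points. Doubly transitive means transitive on ordered pairs of distinct elements. The permutation matrix representation over $\mathbb Q$ sends $g$ to the linear map $(a_1,\dots,a_r)\mapsto(a_{g(1)},\dots,a_{g(r)})$ of $\mathbb Q^r$. $E_{\mathbb Q}$ is spanned by $(1,\dots,1)$, and $E_{\mathbb Q}^\perp$ is its orthogonal complement for the standard inner product. *)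

(* Defs.v *)
From HB Require Import structures.
From mathcomp Require Import all_boot all_order all_algebra all_fingroup.
From mathcomp Require Import primitive_action finmap complex zify.
From mathcomp Require Import all_classical all_reals all_analysis.

Set Implicit Arguments.
Unset Strict Implicit.
Unset Printing Implicit Defensive.

Import Order.TTheory GRing.Theory Num.Theory.
Import numFieldNormedType.Exports.

Local Open Scope classical_set_scope.
Local Open Scope ring_scope.
Local Open Scope complex_scope.

(* The complex numbers, named as a numClosedFieldType so that the normed-field
   topology on numeric fields applies; in particular [derivable f z 1] for
   [f : cplx R -> cplx R] is complex differentiability at z. *)
Definition cplx (R : realType) : numClosedFieldType := R[i].

(* Laurent polynomials are given by their coefficients; they are regarded as
   functions on the nonzero complex numbers through [leval]. *)
Definition laurent (R : realType) := {fsfun int -> cplx R with 0}.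

Section LaurentPolynomials.
Context {R : realType}.
Local Notation C := (cplx R).
Implicit Types L M : laurent R.

Definition leval L (z : C) : C := \sum_(k <- finsupp L) L k * z ^ k.

Definition lproper L : Prop :=
  ~ (forall k : int, k < 0 -> L k = 0) /\ ~ (forall k : int, 0 < k -> L k = 0).

Definition principal0 M : laurent R :=
  [fsfun k in finsupp M => if (k < 0)%R then M k else 0].

Definition principaloo M : laurent R :=
  [fsfun k in finsupp M => if (k < 0)%R then 0 else M k].

Definition pole_order0 L : nat :=
  (\max_(k <- finsupp L | (k < 0)%R) `|k|)%N.

Definition lnumer L : {poly C} :=
  \sum_(k <- finsupp L) L k *: 'X^(absz (k + (pole_order0 L)%:Z)).

(* L = lnumer L / z^n with n = pole_order0 L is a fraction in lowest terms
   (lemmas lnumerE and lnumer_coprime below), so this is the degree of L as a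
   rational function. *)
Definition ldegree L : nat := maxn (size (lnumer L)).-1 (pole_order0 L).

Lemma finsupp_ge_pole_order0 L k :
  k \in finsupp L -> 0 <= k + (pole_order0 L)%:Z.
Proof.
move=> kL; have [k0|k0] := ltP k 0; last by rewrite addr_ge0.
suff : (`|k| <= pole_order0 L)%N by lia.
exact: (@leq_bigmax_seq _ _ (fun k : int => k < 0) absz k kL k0).
Qed.

Lemma lnumerE L (z : C) : z != 0 ->
  leval L z = (lnumer L).[z] / z ^+ pole_order0 L.
Proof.
move=> z0; rewrite /leval /lnumer horner_sum mulr_suml.
apply: eq_big_seq => k kL; rewrite hornerZ hornerXn -mulrA; congr (_ * _).
rewrite !exprnP gez0_abs ?finsupp_ge_pole_order0//.
by rewrite expfzDr// mulfK// expfz_neq0.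
Qed.

Lemma lnumer_coprime L : coprimep (lnumer L) 'X^(pole_order0 L).
Proof.
have [n0|n0] := posnP (pole_order0 L); first by rewrite n0 expr0 coprimep1.
apply: coprimep_expr; rewrite coprimepX.
have [k [kL k0 kn]] : exists k : int,
    [/\ k \in finsupp L, k < 0 & `|k|%N = pole_order0 L].
  apply: contrapT => nk.
  suff : (pole_order0 L <= (pole_order0 L).-1)%N by lia.
  apply/bigmax_leqP_seq => k kL k0.
  have := @leq_bigmax_seq _ _ (fun k : int => k < 0) absz k kL k0.
  rewrite -/(pole_order0 L) => kn.
  suff : `|k|%N != pole_order0 L by lia.
  by apply/eqP => kE; apply: nk; exists k.
rewrite rootE horner_sum (bigD1_seq k kL (fset_uniq _)).
rewrite big_seq_cond big1 => [|j /andP[jL jk]].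
  have -> : absz (k + (pole_order0 L)%:Z) = 0%N by lia.
  by rewrite /= addr0 hornerZ hornerXn expr0 mulr1 -mem_finsupp.
rewrite hornerZ hornerXn expr0n.
have /negPf -> : absz (j + (pole_order0 L)%:Z) != 0%N; last by rewrite mulr0.
by move: jk; apply: contraNneq; lia.
Qed.

Definition cexpi (x : R) : C := cos x +i* sin x.

Definition circle_integral (g : C -> C) : C :=
  let h x : R[i] := g (cexpi x) * ((0 +i* 1) * cexpi x) in
  (\int[lebesgue_measure]_(x in `[0, 2 * pi]) complex.Re (h x))%R
    +i* (\int[lebesgue_measure]_(x in `[0, 2 * pi]) complex.Im (h x))%R.

Definition moment L M (i : nat) : C :=
  circle_integral (fun z => leval L z ^+ i * derive1 (leval M) z).

End LaurentPolynomials.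

Section Branches.
Context {R : realType}.
Local Notation C := (cplx R).
Local Notation I01 := (`[0, 1]%classic : set R).

Definition simply_connected_domain (U : set C) : Prop :=
  [/\ open U, connected U, U !=set0 &
    forall g : R -> C,
      {within I01, continuous g} ->
      (forall s, I01 s -> U (g s)) -> g 0 = g 1 ->
      exists H : R * R -> C,
        [/\ {within I01 `*` I01, continuous H},
            forall p, (I01 `*` I01) p -> U (H p),
            forall s, I01 s -> H (0, s) = g s /\ H (1, s) = g 0 &
            forall u, I01 u -> H (u, 0) = g 0 /\ H (u, 1) = g 0]].

(* Neighbourhoods of the point at infinity of the Riemann sphere. *)
Definition cinfty_nbhs : set_system C :=
  [set P | exists K : R, forall z : C, K%:C < `|z| -> P z].

(* For U included in C, this says that infinity is in the boundary of U. *)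
Definition unbounded_set (U : set C) : Prop :=
  forall K : R, exists2 z : C, U z & K%:C < `|z|.

(* Finite branch points of the inverse of L: since the poles 0 and infinity of
   a proper L lie over infinity, these are the critical values of L on the
   nonzero complex numbers. *)
Definition branch_points (L : laurent R) : set C :=
  [set t | exists z, [/\ z != 0, leval L z = t & derive1 (leval L) z = 0]].

Definition inverse_branches (L : laurent R) (U : set C)
    (f : 'I_(ldegree L) -> C -> C) : Prop :=
  [/\ forall i t, U t -> derivable (f i) t 1,
      forall i t, U t -> f i t != 0 /\ leval L (f i t) = t &
      forall i j, i != j -> exists2 t, U t & f i t != f j t].

Definition J0 (U : set C) r (f : 'I_r -> C -> C) : {set 'I_r} :=
  [set i | `[< f i t @[t --> within U cinfty_nbhs] --> (0 : C) >]]%SET.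

Definition Joo (U : set C) r (f : 'I_r -> C -> C) : {set 'I_r} :=
  [set i | `[< f i t @[t --> within U cinfty_nbhs] --> cinfty_nbhs >]]%SET.

(* h is an analytic continuation along the path g, on [0, 1], of the germ of
   phi at g 0 to the germ of psi at g 1, through function elements of the
   algebraic function inverse to L. *)
Definition analytic_continuation (L : laurent R) (g : R -> C)
    (phi psi : C -> C) : Prop :=
  exists h : R -> C -> C,
    [/\ \forall z \near g 0, h 0 z = phi z,
        \forall z \near g 1, h 1 z = psi z &
        forall s, I01 s ->
          (\forall z \near g s,
             [/\ derivable (h s) z 1, h s z != 0 & leval L (h s z) = z]) /\
          (\forall s' \near within I01 (nbhs s),
             \forall z \near g s', h s' z = h s z)].

(* The set of permutations of the branches f i induced by analytic
   continuation along the loops based at t0. *)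
Definition monodromy_group (L : laurent R) (t0 : C)
    (f : 'I_(ldegree L) -> C -> C) : {set 'S_(ldegree L)} :=
  [set sigma : 'S_(ldegree L) | `[< exists g : R -> C,
     [/\ {within I01, continuous g},
         forall s, I01 s -> ~ branch_points L (g s),
         g 0 = t0, g 1 = t0 &
         forall i, analytic_continuation L g (f i) (f (sigma i))] >]]%SET.

End Branches.

Section PermutationRepresentation.
Variable r : nat.
Local Notation V := 'rV[rat]_r.

(* [col_perm g] maps (a_1, ..., a_r) to (a_(g 1), ..., a_(g r)). *)
Definition invariant_subspace (G : {set 'S_r}) (W : {vspace V}) : Prop :=
  forall g, g \in G -> forall a : V, a \in W -> col_perm g a \in W.

Definition EQ : {vspace V} := <[const_mx 1]>%VS.

(* [a *m b^T] is the standard inner product of the row vectors a and b. *)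
Definition EQ_orth : {vspace V} :=
  lker (linfun (mulmxr (const_mx 1 : V)^T)).

Definition only_trivial_invariant_subspaces (G : {set 'S_r}) : Prop :=
  forall W : {vspace V}, invariant_subspace G W ->
    [\/ W = 0%VS, W = fullv, W = EQ | W = EQ_orth].

End PermutationRepresentation.

(* Main.v *)
Require Import Defs.
From HB Require Import structures.
From mathcomp Require Import all_boot all_order all_algebra all_fingroup.
From mathcomp Require Import primitive_action cyclic separable finmap complex.
From mathcomp Require Import zify ring.
From mathcomp Require Import all_classical all_reals all_analysis.

(** Write [L = p / z ^ n] in lowest terms.  Integrating term by term, the i-th
    moment is [2 pi i] times [c_i], the coefficient of [1 / z] in [L ^ i * M'].  For
    [|t|] large, the average of [z ^ k * z * L' / (L - t)] over the roots of unity
    of large order, computed once by partial fractions over the roots [x] of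
    [p - t z ^ n] and once by expanding [1 / (L - t)] in powers of [1 / t], gives
      [F(t) := sum_(|x| < 1) M_oo(x) - sum_(|x| > 1) M_0(x) = sum_j c_j / (j t ^ j)]
    asymptotically.  If [c_i = 0] for [i >= i0], then [F] is a polynomial in [1 / t];
    it is also integral over [C[t]], since the [x], the [1 / x] and the indicators
    are, hence it is constant and all moments vanish.  So the moments vanish if and
    only if [F = 0] near infinity, which is the second claim.

    Since [sum_x M_0(x)] is a polynomial in [t] by Newton's identities, [F = 0] means
    that [sum_(i in S) M(f_i(t))] is a polynomial, where [S] is the set of the [n]
    small branches.  The rational vectors [a] such that [sum_i a_i M(f_i)] is a
    polynomial form a space invariant under monodromy which contains the indicator
    of [S]; as [0 < n < r], it is everything, so each [M(f_i)] is a polynomial in [t].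
    Analytic continuation of such relations uses, in place of Cauchy's theory, that
    the functions involved are continuous and integral over [C[t]]. *)

Set Implicit Arguments.
Unset Strict Implicit.
Unset Printing Implicit Defensive.

Import Order.TTheory GRing.Theory Num.Theory.
Import numFieldNormedType.Exports.

Local Open Scope classical_set_scope.
Local Open Scope ring_scope.

(** * Averages over roots of unity *)

(** Averages over [m]-th roots of unity take the place of contour integrals and residues. Such an
    average is exact on a Laurent polynomial once [m] exceeds all its exponents, so the only limit
    in [m] is that of the partial fractions, where [x ^+ m] tends to 0 or to infinity according to
    the side of the unit circle on which [x] lies. The logarithmic derivative [z L' / (L - t)]
    counts each root with its multiplicity, so fibers with multiple roots need no separate
    treatment. The circle separates small from large roots as soon as [|t|] exceeds the maximum of
    [|L|] on it. A polynomial in [1 / t] that is integral over [C[t]] is constant because [C[t]] is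
    integrally closed. Integrality is taken in the ring of all functions from C to C, so roots may
    be picked by choice at each [t] and cut off by indicators. The price is that this ring has zero
    divisors: an equation cannot be divided by a function, an obstacle that shapes the identity
    theorem. *)

Lemma prim_root_exists (F : numClosedFieldType) m :
  (0 < m)%N -> exists w : F, m.-primitive_root w.
Proof.
move=> m0; pose p : {poly F} := 'X^m - 1.
have [r Dp] := closed_field_poly_normal p.
rewrite (monicP _) ?monicXnsubC // scale1r in Dp.
have rm1 : all m.-unity_root r by apply/allP => z; rewrite -root_prod_XsubC -Dp.
have szr : (m < (size r).+1)%N.
  by rewrite -(size_prod_XsubC r id) -Dp size_XnsubC.
have [|z _ zm] := hasP (has_prim_root m0 rm1 _ szr); last by exists z.
by rewrite -separable_prod_XsubC -Dp cyclotomic.separable_Xn_sub_1 // pnatr_eq0 -lt0n.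
Qed.

Section UnityAverage.
Variables (F : numClosedFieldType) (m : nat) (w : F).
Hypothesis wm : m.-primitive_root w.

(** A quadrature for the integral of [g(z) dz / (2 pi i z)] over the unit circle, exact on [z ^ e]
    when [|e| < m]. *)
Definition uavg (g : F -> F) : F := m%:R^-1 * \sum_(i < m) g (w ^+ i).

Let m0 : (0 < m)%N. Proof. exact: prim_order_gt0 wm. Qed.
Let mF : m%:R != 0 :> F. Proof. by rewrite pnatr_eq0 -lt0n. Qed.
Let w0 : w != 0. Proof.
apply: contra_eq_neq (prim_expr_order wm) => ->.
by rewrite expr0n -[m == 0%N]negbK -lt0n m0 eq_sym oner_eq0.
Qed.

Lemma uavg_eq g h : (forall z, z ^+ m = 1 -> g z = h z) -> uavg g = uavg h.
Proof.
move=> gh; congr (_ * _); apply: eq_bigr => i _; apply: gh.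
by rewrite exprAC (prim_expr_order wm) expr1n.
Qed.

Lemma uavgD g h : uavg (fun z => g z + h z) = uavg g + uavg h.
Proof. by rewrite /uavg big_split mulrDr. Qed.

Lemma uavgZ a g : uavg (fun z => a * g z) = a * uavg g.
Proof. by rewrite /uavg -mulr_sumr mulrCA. Qed.

Lemma uavgN g : uavg (fun z => - g z) = - uavg g.
Proof. by rewrite /uavg sumrN mulrN. Qed.

Lemma uavg_sum (I : Type) (s : seq I) (P : pred I) (G : I -> F -> F) :
  uavg (fun z => \sum_(i <- s | P i) G i z) = \sum_(i <- s | P i) uavg (G i).
Proof. by rewrite /uavg exchange_big mulr_sumr. Qed.

Lemma norm_uavg_le g b : (forall z, z ^+ m = 1 -> `|g z| <= b) -> `|uavg g| <= b.
Proof.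
move=> gb; rewrite normrM normfV normr_nat mulrC ler_pdivrMr ?ltr0n//.
apply: le_trans (ler_norm_sum _ _ _) _.
have -> : b * m%:R = \sum_(i < m) b by rewrite sumr_const card_ord mulr_natr.
apply: ler_sum => i _; apply: gb.
by rewrite exprAC (prim_expr_order wm) expr1n.
Qed.

Lemma prim_root_exprz_eq1 (e : int) : (w ^ e == 1) = (m %| e)%Z.
Proof.
case: e => n; first by rewrite -exprnP -(prim_order_dvd wm).
by rewrite NegzE -exprz_inv -exprnP exprVn invr_eq1 -(prim_order_dvd wm).
Qed.

Lemma uavg_exprz (e : int) : uavg (fun z => z ^ e) = (m %| e)%Z%:R.
Proof.
rewrite /uavg (eq_bigr (fun i : 'I_m => (w ^ e) ^+ i)); last first.
  by move=> i _; rewrite !exprnP !exprz_exp mulrC.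
rewrite -prim_root_exprz_eq1; have [->|u1] := eqVneq (w ^ e) 1.
  rewrite (eq_bigr (fun=> 1)); last by move=> i _; rewrite expr1n.
  by rewrite sumr_const card_ord mulVf.
have : (w ^ e - 1) * \sum_(i < m) (w ^ e) ^+ i = 0.
  rewrite -subrX1 exprnP exprz_exp mulrC -exprz_exp -exprnP.
  by rewrite (prim_expr_order wm) exp1rz subrr.
by move/eqP; rewrite mulf_eq0 subr_eq0 (negPf u1) /= => /eqP ->; rewrite mulr0.
Qed.

(** Where [z ^+ m = 1], the factor [1 - x ^+ m] equals [z ^+ m - x ^+ m], which [z - x] divides.
    Hence [z / (z - x)] is a combination of the [z ^- l] with [l < m], and only [l = k] modulo [m]
    survives the average. *)
Lemma uavg_cauchy (k : int) (x : F) : x ^+ m != 1 ->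
  uavg (fun z => z ^ k * (z / (z - x))) = x ^+ `|(k %% m)%Z|%N / (1 - x ^+ m).
Proof.
move=> xm; have d0 : 1 - x ^+ m != 0 by rewrite subr_eq0 eq_sym.
pose K := `|(k %% m)%Z|%N.
have KE : (K : int) = (k %% m)%Z by rewrite /K gez0_abs // modz_ge0 // -lt0n.
have Km : (K < m)%N by rewrite -ltz_nat KE ltz_pmod.
transitivity (uavg (fun z =>
    \sum_(l < m) (x ^+ l / (1 - x ^+ m)) * z ^ (k - (l : nat)%:Z))).
  apply: uavg_eq => z zm.
  have z0 : z != 0.
    by apply: contra_eq_neq zm => ->; rewrite expr0n gtn_eqF// eq_sym oner_eq0.
  have zx : z - x != 0.
    by apply: contraNneq xm => /eqP; rewrite subr_eq0 => /eqP <-; rewrite zm.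
  apply: (mulfI d0); rewrite mulr_sumr -{1}zm subrXX.
  transitivity (z ^ k * (z * \sum_(i < m) z ^+ (m.-1 - i) * x ^+ i)).
    by field.
  rewrite !mulr_sumr; apply: eq_bigr => i _.
  have -> : z * (z ^+ (m.-1 - i) * x ^+ i) = z ^- i * x ^+ i.
    rewrite mulrA -exprS; congr (_ * _); apply: (mulIf (expf_neq0 i z0)).
    rewrite mulVf ?expf_neq0// -exprD -zm; congr (_ ^+ _).
    by have := ltn_ord i; lia.
  by rewrite expfzDr// -exprnN; field; rewrite expf_neq0.
rewrite uavg_sum (bigD1 (Ordinal Km))//= big1 => [|l lK].
  rewrite uavgZ uavg_exprz KE addr0.
  suff -> : (m %| k - (k %% m)%Z)%Z by rewrite mulr1.
  by rewrite {1}(divz_eq k m) addrK dvdz_mull.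
rewrite uavgZ uavg_exprz; case: (boolP (m %| _)%Z) => [|_]; last by rewrite mulr0.
rewrite -eqz_mod_dvd => /eqP e; case/eqP: lK; apply: val_inj => /=.
apply/eqP; rewrite -eqz_nat KE e modz_small //.
by rewrite ltz_nat ltn_ord.
Qed.

End UnityAverage.

(** * Power sums of the inverses of the roots *)

Lemma deriv_prod_XsubC (F : fieldType) (xs : seq F) :
  (\prod_(x <- xs) ('X - x%:P))^`() =
  \sum_(y <- xs) (\prod_(x <- xs) ('X - x%:P)) %/ ('X - y%:P).
Proof.
elim: xs => [|a xs IH]; first by rewrite !big_nil derivC.
rewrite !big_cons derivM derivXsubC mul1r IH mulKp ?polyXsubC_eq0//.
congr (_ + _); rewrite mulr_sumr; apply: eq_big_seq => y yxs.
by rewrite divp_mulA // dvdp_XsubCl root_prod_XsubC.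
Qed.

Lemma log_deriv_prod_XsubC (F : fieldType) (xs : seq F) (z : F) : z \notin xs ->
  (\prod_(x <- xs) ('X - x%:P))^`().[z] / (\prod_(x <- xs) ('X - x%:P)).[z] =
  \sum_(x <- xs) (z - x)^-1.
Proof.
move=> zxs; set P := \prod_(x <- xs) _.
have Pz : P.[z] != 0 by rewrite -[_ == 0]/(root P z) root_prod_XsubC.
rewrite deriv_prod_XsubC horner_sum mulr_suml; apply: eq_big_seq => x xxs.
have zx : z - x != 0.
  by rewrite subr_eq0; apply: contraNneq zxs => ->.
apply: (mulIf Pz); rewrite mulfVK// -/P.
have xP : 'X - x%:P %| P by rewrite dvdp_XsubCl root_prod_XsubC.
by rewrite -{2}(divpK xP) hornerM hornerXsubC mulrCA mulVf// mulr1.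
Qed.

(** It holds root by root: [P'] is the sum of the quotients [Q = P / (X - x)], and [Q] is the power
    series of [- x^-1 P / (1 - X / x)]. *)
Lemma newton_inv (F : fieldType) (xs : seq F) (i : nat) : 0 \notin xs ->
  let P := \prod_(x <- xs) ('X - x%:P) in
  P`_i.+1 *+ i.+1 =
  - \sum_(j < i.+1) P`_j * \sum_(x <- xs) x^-1 ^+ (i - j).+1.
Proof.
move=> xs0 P; rewrite -coef_deriv deriv_prod_XsubC coef_sum -/P.
under [X in - X]eq_bigr do rewrite mulr_sumr.
rewrite exchange_big -sumrN; apply: eq_big_seq => x xxs.
have x0 : x != 0 by apply: contraNneq xs0 => <-.
have xP : 'X - x%:P %| P by rewrite dvdp_XsubCl root_prod_XsubC.
set Q := P %/ _; have PE : P = Q * ('X - x%:P) by rewrite divpK.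
have P0 : P`_0 = - (Q`_0 * x) by rewrite PE mulrBr coefB coefMX coefMC sub0r.
have PS j : P`_j.+1 = Q`_j - Q`_j.+1 * x by rewrite PE mulrBr coefB coefMX coefMC.
elim: i => [|i IH].
  by rewrite big_ord1 subnn expr1 P0 mulNr mulfK// opprK.
rewrite big_ord_recr /= subnn expr1 PS opprD mulrBl mulfK//.
rewrite (eq_bigr (fun j : 'I_i.+1 => (P`_j * x^-1 ^+ (i - j).+1) * x^-1)).
  by rewrite -mulr_suml -mulNr -IH; ring.
by move=> j _; rewrite -mulrA -exprSr subSn // -ltnS.
Qed.

(** The coefficients of [p - t X^n] are affine in [t], and since [0 < n] the constant one is
    [p.[0]]. Newton's recursion thus divides only by a constant and stays polynomial in [t]. *)
Lemma fiber_power_sum_inv (F : numFieldType) (p : {poly F}) (n k : nat) :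
  (0 < n)%N -> p.[0] != 0 ->
  exists D : {poly F}, forall (t c : F) (xs : seq F), c != 0 ->
    p - t *: 'X^n = c *: \prod_(x <- xs) ('X - x%:P) ->
    \sum_(x <- xs) x^-1 ^+ k.+1 = D.[t] .
Proof.
move=> n0 p0; have [m] := ubnP k; elim: m k => // m IH k; rewrite ltnS => km.
pose coefp j : {poly F} := (p`_j)%:P - ((j == n)%:R *: 'X).
have [D DE] : exists D : nat -> {poly F}, forall j, (j < k)%N ->
    forall (t c : F) (xs : seq F), c != 0 ->
    p - t *: 'X^n = c *: \prod_(x <- xs) ('X - x%:P) ->
    \sum_(x <- xs) x^-1 ^+ j.+1 = (D j).[t].
  suff /choice[D DE] : forall j, exists D : {poly F}, (j < k)%N ->
    forall (t c : F) (xs : seq F), c != 0 ->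
    p - t *: 'X^n = c *: \prod_(x <- xs) ('X - x%:P) ->
    \sum_(x <- xs) x^-1 ^+ j.+1 = D.[t] by exists D.
  move=> j; have [jk|_] := ltnP j k; last by exists 0.
  by have [D DE] := IH j (leq_trans jk km); exists D.
(* [newton_inv] times [c], solved for its highest power sum, with [coefp j] in place of
   [c * P_j]. *)
exists (- (p.[0])^-1 *: (coefp k.+1 *+ k.+1 +
   \sum_(j < k) coefp j.+1 * D (k - j.+1)%N)).
move=> t c xs c0 pE; set P := \prod_(x <- xs) _ in pE.
have PcE j : c * P`_j = (coefp j).[t].
  have := congr1 (fun q : {poly F} => q`_j) pE.
  rewrite coefZ => <-; rewrite coefB coefZ coefXn !hornerE.
  by rewrite mulrC.
have xs0 : 0 \notin xs.
  rewrite -root_prod_XsubC -/P; apply: contra p0 => /eqP P0.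
  have := congr1 (fun q : {poly F} => q.[0]) pE.
  rewrite hornerZ P0 mulr0 !hornerE expr0n (gtn_eqF n0) mulr0 subr0 => ->.
  by rewrite eqxx.
have cP0 : c * P`_0 = p.[0].
  by rewrite PcE !hornerE (ltn_eqF n0) mul0r subr0 -horner_coef0.
have := newton_inv k xs0; rewrite -/P /= => N.
have := congr1 (fun a => c * a) N.
rewrite mulrnAr PcE big_ord_recl subn0 mulrN mulrDr mulrA cP0.
set s := \sum_(x <- xs) _ => e.
rewrite hornerZ hornerD hornerMn horner_sum e.
under [X in _ * (_ + X)]eq_bigr => j _ do rewrite hornerM -PcE
  -(DE (k - j.+1)%N _ t c xs c0 pE) ?ltn_subrL ?(leq_ltn_trans _ (ltn_ord j))//.
set S1 := \sum_(i < k) _; set S2 := \sum_(i < k) _.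
have -> : S2 = c * S1 by rewrite mulr_sumr; apply: eq_bigr => j _; rewrite mulrA.
by rewrite opprD addrNK mulrN mulNr opprK mulKf.
Qed.

(** * Expansion of sums over a fiber *)

Section FiberExpansion.
Variables (F : numClosedFieldType) (p : {poly F}) (n : nat).

(* The coefficient of [z ^ e] in [(p / z ^ n) ^ j]. *)
Definition lcoef (j : nat) (e : int) : F :=
  if 0 <= e + (n * j)%N%:Z then (p ^+ j)`_(absz (e + (n * j)%N%:Z)) else 0.

(* [z ^ n * (z * l'(z))] for [l = p / z ^ n]. *)
Let S : {poly F} := 'X * p^`() - n%:R *: p.

(** For [theta = z d/dz] this is [(j + 1) l^j theta(l) = theta(l^(j+1))], multiplied by
    [z^(n(j+1))]; [theta] scales each monomial by its exponent. *)
Lemma horner_theta_exp (j : nat) (z : F) :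
  j.+1%:R * (S * p ^+ j).[z] =
  \sum_(a < size (p ^+ j.+1)) (a%:R - (n * j.+1)%:R) * (p ^+ j.+1)`_a * z ^+ a.
Proof.
have -> : j.+1%:R * (S * p ^+ j).[z] =
    z * (p ^+ j.+1)^`().[z] - (n * j.+1)%:R * (p ^+ j.+1).[z].
  rewrite /S deriv_exp /= hornerMn !hornerM hornerD hornerN hornerZ hornerM hornerX.
  by rewrite !horner_exp natrM exprS -[_ *+ j.+1]mulr_natl; ring.
have -> : z * (p ^+ j.+1)^`().[z] =
    \sum_(a < size (p ^+ j.+1)) a%:R * (p ^+ j.+1)`_a * z ^+ a.
  have [/eqP|q0] := posnP (size (p ^+ j.+1)).
    by rewrite size_poly_eq0 => /eqP ->; rewrite size_poly0 big_ord0 derivC horner0 mulr0.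
  have sz : (size (p ^+ j.+1)^`() <= (size (p ^+ j.+1)).-1)%N.
    apply/leq_sizeP => i iq; rewrite coef_deriv nth_default ?mul0rn//.
    by apply: leq_trans (leqSpred _) _; rewrite ltnS.
  rewrite (horner_coef_wide _ sz) mulr_sumr -(prednK q0) big_ord_recl /= mul0r mul0r add0r.
  by apply: eq_bigr => i _; rewrite coef_deriv /bump leq0n add1n [z ^+ _.+1]exprS -mulr_natl; ring.
by rewrite horner_coef mulr_sumr -sumrB; apply: eq_bigr => a _; ring.
Qed.

Lemma uavg_theta_exp (k : int) (j : nat) : exists m0, forall m (w : F),
  (m0 <= m)%N -> m.-primitive_root w ->
  uavg m w (fun z => z ^ k * (S.[z] / z ^+ n) * (p.[z] / z ^+ n) ^+ j) =
  - k%:~R * lcoef j.+1 (- k) / j.+1%:R.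
Proof.
set q := p ^+ j.+1; pose J := (n * j.+1)%N.
(* Such an [m] exceeds every [|a - J + k|] with [a < size q], so divisibility by [m] means
   vanishing. *)
exists (size q + J + `|k| + 1)%N => m w mm0 wm.
have m0 := prim_order_gt0 wm.
have j0 : j.+1%:R != 0 :> F by rewrite pnatr_eq0.
rewrite (@uavg_eq _ _ _ wm _ (fun z => \sum_(a < size q)
   ((a%:R - J%:R) * q`_a / j.+1%:R) * z ^ ((a : nat)%:Z - J%:Z + k))); last first.
  move=> z zm; have z0 : z != 0.
    by apply: contra_eq_neq zm => ->; rewrite expr0n gtn_eqF// eq_sym oner_eq0.
  apply: (mulfI j0); transitivity (j.+1%:R * (S * p ^+ j).[z] / z ^+ J * z ^ k).
    rewrite hornerM horner_exp expr_div_n /J mulnS exprD exprM.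
    have := expf_neq0 n z0; have := expf_neq0 j (expf_neq0 n z0).
    by move: (S.[z]) (z ^ k) (p.[z] ^+ j) (z ^+ n ^+ j) (z ^+ n) => *; field; apply/andP.
  rewrite horner_theta_exp -/q mulr_suml mulr_suml mulr_sumr; apply: eq_bigr => a _.
  rewrite !expfzDr// -exprnN -exprnP.
  rewrite -/J; move: j0 (_ - _) => j1 d.
  by move: (j.+1%:R) j1 (z ^+ J)^-1 (z ^ k) => *; field.
rewrite uavg_sum; under eq_bigr do rewrite uavgZ (uavg_exprz wm).
have dvE (a : 'I_(size q)) : (m %| (a : nat)%:Z - J%:Z + k)%Z = ((a : nat)%:Z == J%:Z - k).
  apply/idP/eqP => [|->]; last by rewrite (_ : _ + k = 0) ?dvdz0//; ring.
  rewrite dvdzE => aD; move: (ltn_ord a) mm0 aD => /=; rewrite -/J; clearbody J.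
  by move: (size q) (nat_of_ord a) => s a' as' mm0 /dvdn_leq; lia.
rewrite /lcoef -/q -/J addrC; case: ifPn => [Jk|Jk]; last first.
  rewrite mulr0 mul0r big1 => // a _; rewrite dvE.
  case: eqP => [aE|_]; last by rewrite mulr0.
  by move: Jk; rewrite -aE.
have [qs|qs] := leqP (size q) (absz (J%:Z - k)).
  rewrite (nth_default _ qs) mulr0 mul0r big1// => a _; rewrite dvE.
  case: eqP => [aE|_]; last by rewrite mulr0.
  by move: qs; rewrite -aE /= leqNgt ltn_ord.
rewrite (bigD1 (Ordinal qs))// dvE big1 => [|a aqs]; last first.
  rewrite dvE; case: eqP => [aE|_]; last by rewrite mulr0.
  by case/eqP: aqs; apply: val_inj => /=; rewrite -aE.
rewrite /= gez0_abs// eqxx mulr1 addr0; congr (_ * _ / _).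
have -> : (absz (J%:Z - k))%:R = (J%:Z - k)%:~R :> F.
  by rewrite -[in RHS](gez0_abs Jk).
by rewrite intrB -pmulrn addrAC subrr add0r.
Qed.

Lemma normr_unity_root m (z : F) : (0 < m)%N -> z ^+ m = 1 -> `|z| = 1.
Proof.
move=> m0 zm; apply/eqP; rewrite -(@pexpr_eq1 _ _ m) ?normr_ge0//.
  by rewrite -normrX zm normr1.
Qed.

Variables (t c B B' : F) (xs : seq F).
Hypothesis c0 : c != 0.
Hypothesis pE : p - t *: 'X^n = c *: \prod_(x <- xs) ('X - x%:P).
Hypothesis pB : forall z : F, `|z| = 1 -> `|p.[z]| <= B.
Hypothesis SB : forall z : F, `|z| = 1 -> `|S.[z]| <= B'.
Hypothesis tB : B < `|t|.

Let unit_neq0 (z : F) : `|z| = 1 -> z != 0.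
Proof. by move=> z1; rewrite -normr_gt0 z1 ltr01. Qed.

Let lt0 (z : F) : `|z| = 1 -> p.[z] / z ^+ n - t != 0.
Proof.
move=> z1; rewrite subr_eq0; apply/eqP => lt.
have := pB z1; rewrite -(divfK (expf_neq0 n (unit_neq0 z1)) p.[z]) lt.
by rewrite normrM normrX z1 expr1n mulr1 => /(lt_le_trans tB); rewrite ltxx.
Qed.

Lemma fiber_not_unit (x : F) : x \in xs -> `|x| != 1.
Proof.
rewrite -root_prod_XsubC => /eqP x0; apply/eqP => x1.
have := congr1 (fun q : {poly F} => q.[x]) pE; rewrite hornerZ x0 mulr0 !hornerE.
move=> e; case/eqP: (lt0 x1); have z0 := expf_neq0 n (unit_neq0 x1).
by apply: (mulIf z0); rewrite mulrBl divfK// mul0r.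
Qed.

(** Both sides are [z] times the logarithmic derivative of [l - t = c \prod (z - x) / z^n]. *)
Lemma fiber_log_deriv (z : F) : `|z| = 1 ->
  \sum_(x <- xs) z / (z - x) - n%:R = (S.[z] / z ^+ n) / (p.[z] / z ^+ n - t).
Proof.
move=> z1; have z0 := unit_neq0 z1.
have zxs : z \notin xs by apply/negP => /fiber_not_unit; rewrite z1 eqxx.
rewrite -mulr_sumr -log_deriv_prod_XsubC//; set P := \prod_(x <- xs) _.
have Pz : P.[z] != 0 by rewrite -[_ == 0]/(root P z) root_prod_XsubC.
have e : c * P.[z] = p.[z] - t * z ^+ n.
  by rewrite -hornerZ -pE !hornerE.
have e' : c * P^`().[z] = p^`().[z] - t * (z ^+ n.-1 *+ n).
  by rewrite -hornerZ -derivZ -pE derivB derivZ derivXn !hornerE hornerMn hornerXn.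
have -> : z * (P^`().[z] / P.[z]) = z * (c * P^`().[z]) / (c * P.[z]).
  by field; rewrite ?c0 ?Pz.
rewrite e e' /S !hornerE; set v := p.[z]; set v' := p^`().[z].
have zn0 := expf_neq0 n z0.
have -> : v / z ^+ n - t = (v - t * z ^+ n) / z ^+ n by field.
have vt : v - t * z ^+ n != 0 by rewrite -e mulf_neq0.
have -> : z * (v' - t * (z ^+ n.-1 *+ n)) = z * v' - t * (n%:R * z ^+ n).
  case: (n) => [|n']; first by rewrite mulr0n mul0r !mulr0 !subr0.
  by rewrite -[_ *+ _]mulr_natl exprS; ring.
by field; rewrite ?vt ?zn0.
Qed.

Lemma geometric_rest (D l : F) (N : nat) : l - t != 0 -> t != 0 ->
  D / (l - t) = - \sum_(j < N) D * l ^+ j * (t^-1) ^+ j.+1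
                + t^-1 ^+ N * (D * l ^+ N / (l - t)).
Proof.
move=> lt t0; elim: N => [|N IH].
  by rewrite big_ord0 oppr0 add0r !expr0 mul1r mulr1.
rewrite big_ord_recr /= {}IH opprD -!addrA; congr (_ + _).
by rewrite !exprS; field; rewrite ?lt ?t0.
Qed.

(** The difference is exactly the average of [z ^ k] times the remainder in [geometric_rest].
    Bounding that remainder on the circle gives an estimate independent of [m]. *)
Lemma fiber_expansion (k : int) (N : nat) : exists m0, forall m (w : F),
  (m0 <= m)%N -> m.-primitive_root w ->
  `|\sum_(x <- xs) x ^+ `|(k %% m)%Z|%N / (1 - x ^+ m) - n%:R * (k == 0)%:R
    - \sum_(j < N) t^-1 ^+ j.+1 * (k%:~R * lcoef j.+1 (- k) / j.+1%:R)|
  <= B' * B ^+ N * `|t|^-1 ^+ N / (`|t| - B).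
Proof.
have /choice[m1 m1P] := uavg_theta_exp k.
exists (\max_(j < N) m1 j + `|k| + 1)%N => m w mm wm.
have m0 := prim_order_gt0 wm.
have B0 : 0 <= B.
  by apply: le_trans (pB (normr1 _)); rewrite normr_ge0.
have t0 : t != 0 by rewrite -normr_gt0 (le_lt_trans B0).
have <- : uavg m w (fun z => z ^ k) = (k == 0)%:R.
  rewrite (uavg_exprz wm); congr (_%:R); congr nat_of_bool.
  apply/idP/eqP => [|->]; last by rewrite dvdz0.
  rewrite dvdzE => /dvdn_leq; lia.
have -> : \sum_(x <- xs) x ^+ `|(k %% m)%Z|%N / (1 - x ^+ m) =
    \sum_(x <- xs) uavg m w (fun z => z ^ k * (z / (z - x))).
  apply: eq_big_seq => x xxs; rewrite uavg_cauchy//.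
  by apply/eqP => /(normr_unity_root m0)/eqP; apply/negP/fiber_not_unit.
have -> : \sum_(j < N) t^-1 ^+ j.+1 * (k%:~R * lcoef j.+1 (- k) / j.+1%:R) =
    - \sum_(j < N) uavg m w (fun z => t^-1 ^+ j.+1 *
       (z ^ k * (S.[z] / z ^+ n) * (p.[z] / z ^+ n) ^+ j)).
  rewrite -sumrN; apply: eq_bigr => j _; rewrite uavgZ m1P//; first by ring.
  apply: leq_trans mm; rewrite -addnA; apply: leq_trans (leq_addr _ _).
  by rewrite leq_bigmax.
rewrite opprK.
have -> : forall a b d : F, a - b + d = a + (- b + d) by move=> *; rewrite addrA.
rewrite -!uavg_sum -uavgZ -uavgN -!uavgD.
apply: norm_uavg_le => // z zm; have z1 := normr_unity_root m0 zm.
have -> : \sum_(x <- xs) z ^ k * (z / (z - x)) + (- (n%:R * z ^ k) +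
  \sum_(j < N) t^-1 ^+ j.+1 * (z ^ k * (S.[z] / z ^+ n) * (p.[z] / z ^+ n) ^+ j))
  = z ^ k * (t^-1 ^+ N * (S.[z] / z ^+ n * (p.[z] / z ^+ n) ^+ N /
             (p.[z] / z ^+ n - t))).
  rewrite addrA -mulr_sumr [n%:R * _]mulrC -mulrBr fiber_log_deriv//.
  rewrite (geometric_rest _ N (lt0 z1) t0) mulrDr mulrN addrAC mulr_sumr.
  rewrite (eq_bigr (fun j : 'I_N => t^-1 ^+ j.+1 *
    (z ^ k * (S.[z] / z ^+ n) * (p.[z] / z ^+ n) ^+ j))) ?addNr ?add0r//.
  by move=> j _; ring.
have zn : `|z ^+ n| = 1 by rewrite normrX z1 expr1n.
have zk : `|z ^ k| = 1.
  by case: (k) => i; rewrite ?NegzE -?exprnN -?exprnP ?normfV normrX z1 expr1n ?invr1.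
have lz : `|p.[z] / z ^+ n| <= B by rewrite normrM normfV zn invr1 mulr1 pB.
have Dz : `|S.[z] / z ^+ n| <= B' by rewrite normrM normfV zn invr1 mulr1 SB.
have := lt0 z1; move: lz Dz; move: (p.[z] / _) (S.[z] / _) => l D lz Dz lz0.
have d0 : 0 < `|t| - B by rewrite subr_gt0.
rewrite !(normrM, normfV, normrX) zk mul1r.
have -> : B' * B ^+ N * `|t|^-1 ^+ N / (`|t| - B) =
  `|t|^-1 ^+ N * (B' * B ^+ N / (`|t| - B)) by move: (_ - _)^-1 => *; ring.
rewrite ler_wpM2l ?exprn_ge0 ?invr_ge0//.
apply: ler_pM; rewrite ?mulr_ge0 ?exprn_ge0 ?invr_ge0//.
  apply: ler_pM; [exact: normr_ge0|by rewrite exprn_ge0|exact: Dz|].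
  by apply: lerXn2r; rewrite ?nnegrE.
rewrite lef_pV2 ?posrE ?normr_gt0//.
rewrite distrC; apply: le_trans (lerB_dist _ _).
by rewrite lerB.
Qed.

End FiberExpansion.

(** * Limits of the averages as the order of the roots of unity grows *)

Lemma cvg_expc0 (R : realType) (x : cplx R) :
  `|x| < 1 -> x ^+ m @[m --> \oo] --> (0 : cplx R).
Proof.
move=> x1; have [r xr] : exists r : R, `|x| = r%:C%C.
  by apply/complex_realP; exact: normr_real.
have r1 : `|r| < 1.
  have r0 : 0 <= r by rewrite -lecR -xr; exact: normr_ge0.
  by rewrite ger0_norm // -ltcR -xr.
apply/cvgrPdist_lt => e e0.
have [d ed] : exists d : R, e = d%:C%C.
  by apply/complex_realP; exact: gtr0_real.
have d0 : 0 < d by rewrite -ltcR -ed.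
have /cvgr_dist_lt/(_ _ d0) := cvg_expr r1.
apply: filterS => m; rewrite sub0r normrN => rd.
rewrite sub0r normrN normrX xr ed -rmorphXn ltcR.
by apply: le_lt_trans rd; exact: ler_norm.
Qed.

Section RootWeight.
Variable R : realType.
Local Notation C := (cplx R).

Let cvg_mul (u v : nat -> C) (a b : C) :
  u m @[m --> \oo] --> a -> v m @[m --> \oo] --> b ->
  u m * v m @[m --> \oo] --> a * b.
Proof. by move=> ua vb; exact: (cvgM ua vb). Qed.

Let cvg_cstmul (v : nat -> C) (a b : C) :
  v m @[m --> \oo] --> b -> a * v m @[m --> \oo] --> a * b.
Proof. by move=> vb; exact: (cvg_mul (u := fun=> a) (cvg_cst a) vb). Qed.

(* The limit of the averages of [z ^ k * (z / (z - x))] over the m-th roots of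
   unity, that is the integral of [z ^ k / (z - x)] over the unit circle. *)
Definition root_weight (k : int) (x : C) : C :=
  if `|x| < 1 then if 0 <= k then x ^ k else 0
  else if 0 <= k then 0 else - x ^ k.

Definition root_avg (k : int) (x : C) (m : nat) : C :=
  x ^+ `|(k %% m%:Z)%Z|%N / (1 - x ^+ m).

Lemma cvg_root_weight (k : int) (x : C) : x != 0 -> `|x| != 1 ->
  root_avg k x m @[m --> \oo] --> root_weight k x.
Proof.
move=> x0 x1.
have near_eq (u : nat -> C) (l : C) : (exists m0, forall m, (m0 <= m)%N ->
    u m = root_avg k x m) -> u m @[m --> \oo] --> l ->
    root_avg k x m @[m --> \oo] --> l.
  move=> [m0 uE]; apply: cvg_trans; apply: near_eq_cvg.
  by exists m0 => // m /= mm; rewrite uE.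
(* For large [m] the residue of [k] modulo [m] is [k] if [k >= 0] and [k + m] otherwise. *)
have absE (m : nat) : (`|k| < m)%N ->
    x ^+ `|(k %% m%:Z)%Z|%N = x ^ k * (if 0 <= k then 1 else x ^+ m).
  move=> km; case: k near_eq km => i _ km /=.
    by rewrite modz_nat modn_small// mulr1.
  have -> : (Negz i %% m)%Z = (m - i.+1)%N%:Z.
    by rewrite modNz_nat ?modn_small; lia.
  by rewrite /= expfB // mulrC.
have yE : `|x| > 1 -> `|x^-1| < 1.
  by move=> x2; rewrite normfV invf_lt1 // (lt_trans ltr01).
rewrite /root_weight; case: ifPn => [xs|].
  have dE : (1 - x ^+ m)^-1 @[m --> \oo] --> ((1 - 0)^-1 : C).
    apply: cvgV; first by rewrite subr0 oner_neq0.
    apply: cvgB; [exact: cvg_cst|exact: (cvg_expc0 xs)].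
  case: ifPn => k0.
    apply: (near_eq (fun m => x ^ k * (1 - x ^+ m)^-1)).
      by exists `|k|.+1%N => m km; rewrite /root_avg absE// k0 mulr1.
    by have := (cvg_cstmul (v := fun m => _) (a := x ^ k) dE); rewrite subr0 invr1 mulr1.
  apply: (near_eq (fun m => x ^ k * x ^+ m * (1 - x ^+ m)^-1)).
    by exists `|k|.+1%N => m km; rewrite /root_avg absE// (negPf k0).
  by have := (cvg_mul (u := fun m => _) (v := fun m => _)
    (cvg_cstmul (v := fun m => _) (a := x ^ k) (cvg_expc0 xs)) dE); rewrite mulr0 mul0r.
rewrite -real_leNgt ?normr_real// => xl.
have xs : `|x^-1| < 1 by apply: yE; rewrite lt_neqAle eq_sym x1.
have dE : (x^-1 ^+ m - 1)^-1 @[m --> \oo] --> ((0 - 1)^-1 : C).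
  apply: cvgV; first by rewrite sub0r oppr_eq0 oner_neq0.
  exact: (cvgB (cvg_expc0 xs) (cvg_cst (1 : C))).
(* Outside the circle [x ^+ m] diverges, so everything is rewritten in powers of [x^-1]. *)
have inv_eq (m : nat) : (0 < m)%N -> (1 - x ^+ m)^-1 = x^-1 ^+ m * (x^-1 ^+ m - 1)^-1.
  move=> m0; have xm : x ^+ m != 0 by rewrite expf_neq0.
  have d0 : 1 - x ^+ m != 0.
    by rewrite subr_eq0; apply/eqP => /esym/(normr_unity_root m0)/eqP; rewrite (negPf x1).
  have -> : x^-1 ^+ m - 1 = (1 - x ^+ m) / x ^+ m by rewrite exprVn; field.
  by rewrite exprVn; field; rewrite ?d0 ?xm.
case: ifPn => k0.
  apply: (near_eq (fun m => x ^ k * (x^-1 ^+ m * (x^-1 ^+ m - 1)^-1))).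
    by exists `|k|.+1%N => m km; rewrite /root_avg absE// k0 mulr1 inv_eq//; lia.
  by have := (cvg_cstmul (v := fun m => _) (a := x ^ k)
    (cvg_mul (u := fun m => _) (v := fun m => _) (cvg_expc0 xs) dE)); rewrite mul0r mulr0.
apply: (near_eq (fun m => x ^ k * (x^-1 ^+ m - 1)^-1)).
  exists `|k|.+1%N => m km; rewrite /root_avg absE// (negPf k0) inv_eq; last by lia.
  by rewrite -!mulrA [X in _ = _ * X]mulrA exprVn divff ?mul1r// expf_neq0.
by have := (cvg_cstmul (v := fun m => _) (a := x ^ k) dE); rewrite sub0r invrN1 mulrN1.
Qed.

Lemma cvg_sum_seq (I : eqType) (s : seq I) (u : I -> nat -> C) (l : I -> C) :
  (forall i, i \in s -> u i m @[m --> \oo] --> l i) ->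
  \sum_(i <- s) u i m @[m --> \oo] --> \sum_(i <- s) l i.
Proof.
move=> ul; rewrite big_seq; under eq_cvg do rewrite big_seq.
apply: cvg_big => [|i /ul]; [exact: add_continuous|exact].
Qed.

End RootWeight.

(** An explicit bound for [|q|] on the unit circle, which avoids a supremum. *)
Definition poly_norm1 (F : numDomainType) (q : {poly F}) : F :=
  \sum_(i < size q) `|q`_i|.

Lemma poly_norm1_ge0 (F : numDomainType) (q : {poly F}) : 0 <= poly_norm1 q.
Proof. by apply: sumr_ge0 => i _; exact: normr_ge0. Qed.

Lemma norm_horner_unit (F : numDomainType) (q : {poly F}) (z : F) :
  `|z| = 1 -> `|q.[z]| <= poly_norm1 q.
Proof.
move=> z1; rewrite horner_coef; apply: le_trans (ler_norm_sum _ _ _) _.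
by apply: ler_sum => i _; rewrite normrM normrX z1 expr1n mulr1.
Qed.

(** * Expansion of the weighted fiber sums in powers of [1 / t] *)

Section FiberSums.
Variable R : realType.
Local Notation C := (cplx R).
Variables (p : {poly C}) (n : nat).
Hypotheses (n_gt0 : (0 < n)%N) (n_lt : (n < (size p).-1)%N) (p0 : p.[0] != 0).
Implicit Types (M : laurent R) (t x : C) (xs : seq C).

(** [xs] lists the solutions of [L x = t] with multiplicity; as [n] is below the degree of [p], the
    leading coefficient does not depend on [t]. *)
Definition fiber_list t xs : Prop :=
  p - t *: 'X^n = lead_coef p *: \prod_(x <- xs) ('X - x%:P).

(** The summand of [F(t)]: by [weightE] below it is [M_oo(x)] if [|x| < 1] and [- M_0(x)]
    otherwise. *)
Definition weight M x : C := \sum_(k <- finsupp M) M k * root_weight k x.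

(** The coefficient of [1 / z] in [l^j M'], for [l = p / z^n]. *)
Definition moment_coef M (j : nat) : C :=
  \sum_(k <- finsupp M) M k * (k%:~R * lcoef p n j (- k)).

Lemma lead_coef_neq0 : lead_coef p != 0.
Proof. by rewrite lead_coef_eq0 -size_poly_eq0; case: (size p) n_lt. Qed.

Lemma size_fiber_poly t : size (p - t *: 'X^n) = size p.
Proof.
rewrite size_polyDl// size_polyN; apply: leq_ltn_trans (size_scale_leq _ _) _.
by rewrite size_polyXn -ltn_predRL.
Qed.

Lemma lead_coef_fiber_poly t : lead_coef (p - t *: 'X^n) = lead_coef p.
Proof.
rewrite lead_coefDl// size_polyN; apply: leq_ltn_trans (size_scale_leq _ _) _.
by rewrite size_polyXn -ltn_predRL.
Qed.

Lemma fiber_list_exists t : exists xs, fiber_list t xs.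
Proof.
have [xs e] := closed_field_poly_normal (p - t *: 'X^n).
by exists xs; rewrite /fiber_list {1}e lead_coef_fiber_poly.
Qed.

Lemma size_fiber t xs : fiber_list t xs -> size xs = (size p).-1.
Proof.
move=> e; have := size_fiber_poly t.
by rewrite e size_scale ?lead_coef_neq0// size_prod_XsubC => <-.
Qed.

Lemma mem_fiber t xs x : fiber_list t xs ->
  (x \in xs) = (p.[x] == t * x ^+ n).
Proof.
move=> e; rewrite -root_prod_XsubC -(rootZ x _ lead_coef_neq0) -e.
by rewrite /root !hornerE subr_eq0.
Qed.

Lemma fiber_neq0 t xs x : fiber_list t xs -> x \in xs -> x != 0.
Proof.
move=> e; rewrite (mem_fiber _ e); apply: contraTneq => ->.
by rewrite expr0n gtn_eqF// mulr0.
Qed.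

Let S : {poly C} := 'X * p^`() - n%:R *: p.

Lemma fiber_not_unit_circle t xs x : fiber_list t xs ->
  poly_norm1 p < `|t| -> x \in xs -> `|x| != 1.
Proof.
move=> e tB xxs.
exact: (fiber_not_unit e (@norm_horner_unit _ p) tB xxs).
Qed.

(** The bound in [fiber_expansion] does not involve [m], so it survives the limit. *)
Lemma fiber_sum_root_weight t xs k N : fiber_list t xs -> poly_norm1 p < `|t| ->
  `|\sum_(x <- xs) root_weight k x - n%:R * (k == 0)%:R
    - \sum_(j < N) t^-1 ^+ j.+1 * (k%:~R * lcoef p n j.+1 (- k) / j.+1%:R)|
  <= poly_norm1 S * poly_norm1 p ^+ N * `|t|^-1 ^+ N / (`|t| - poly_norm1 p).
Proof.
move=> e tB; apply/ler_addgt0Pr => d d0.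
have [m0 m0P] := fiber_expansion lead_coef_neq0 e (@norm_horner_unit _ p)
   (@norm_horner_unit _ S) tB k N.
have : \sum_(x <- xs) root_avg k x m @[m --> \oo] -->
       \sum_(x <- xs) root_weight k x.
  apply: cvg_sum_seq => x xxs; apply: cvg_root_weight.
    exact: fiber_neq0 e xxs.
  exact: fiber_not_unit_circle e tB xxs.
move=> /cvgr_dist_lt/(_ _ d0) [m1 _ m1P].
have [w wm] := prim_root_exists C (ltn0Sn (m0 + m1)).
have := m0P _ w (leqW (leq_addr _ _)) wm.
have := m1P (m0 + m1).+1 (leqW (leq_addl _ _)).
rewrite /root_avg /=.
set A := \sum_(x <- xs) root_weight k x; set A' := \sum_(x <- xs) _.
set c1 := n%:R * _; set c2 := \sum_(j < N) _; set E := _ / _ => h1 h2.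
have -> : A - c1 - c2 = (A' - c1 - c2) + (A - A') by ring.
by apply: le_trans (ler_normD _ _) _; rewrite lerD// ltW.
Qed.

(** The summand 1 makes the bound positive and gives [|t| - poly_norm1 p >= 1] when
    [|t| > 2 * fiber_bound], which removes the denominator of the error term. *)
Definition fiber_bound : C := 1 + poly_norm1 p.

Lemma fiber_bound_gt0 : 0 < fiber_bound.
Proof. by rewrite ltr_wpDr ?poly_norm1_ge0. Qed.

Lemma fiber_bound_lt t : 2 * fiber_bound < `|t| -> poly_norm1 p < `|t|.
Proof.
apply: lt_trans; rewrite /fiber_bound mulrDr mulr1 mulr_natl mulr2n.
by rewrite ltr_pwDl // lerDl poly_norm1_ge0.
Qed.

(** One [K] serves all [t] and all [N]: letting [N] grow at fixed [t] gives exact formulas, letting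
    [t] grow at fixed [N] determines the coefficients. *)
Lemma fiber_sum_weight M : exists2 K : C, 0 <= K & forall t xs N,
  fiber_list t xs -> 2 * fiber_bound < `|t| ->
  `|\sum_(x <- xs) weight M x - n%:R * M 0
    - \sum_(j < N) t^-1 ^+ j.+1 * (moment_coef M j.+1 / j.+1%:R)|
  <= K * (fiber_bound / `|t|) ^+ N.
Proof.
exists (\sum_(k <- finsupp M) `|M k| * poly_norm1 S).
  by apply: sumr_ge0 => k _; rewrite mulr_ge0 ?poly_norm1_ge0.
move=> t xs N e tB2; have tB := fiber_bound_lt tB2.
have M0E : M 0 = \sum_(k <- finsupp M) M k * (k == 0)%:R.
  have [i|/fsfun_dflt M0] := boolP (0 \in finsupp M).
    rewrite (big_rem (0 : int))//= mulr1 big_seq big1 ?addr0// => k.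
    by rewrite (rem_filter _ (fset_uniq _)) mem_filter => /andP[/negPf /= -> _]; rewrite mulr0.
  rewrite M0 big1// => k _; case: eqP => [->|_]; last by rewrite mulr0.
  by rewrite M0 mul0r.
have -> : \sum_(x <- xs) weight M x - n%:R * M 0
    - \sum_(j < N) t^-1 ^+ j.+1 * (moment_coef M j.+1 / j.+1%:R) =
  \sum_(k <- finsupp M) M k * (\sum_(x <- xs) root_weight k x - n%:R * (k == 0)%:R
    - \sum_(j < N) t^-1 ^+ j.+1 * (k%:~R * lcoef p n j.+1 (- k) / j.+1%:R)).
  under [RHS]eq_bigr do rewrite !mulrBr.
  rewrite !sumrB; congr (_ - _ - _).
  - by rewrite exchange_big; apply: eq_bigr => k _; rewrite mulr_sumr.
  - by rewrite M0E mulr_sumr; apply: eq_bigr => k _; rewrite mulrCA.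
  under [RHS]eq_bigr do rewrite mulr_sumr.
  rewrite exchange_big; apply: eq_bigr => j _.
  rewrite /moment_coef mulr_suml mulr_sumr; apply: eq_bigr => k _.
  by ring.
apply: le_trans (ler_norm_sum _ _ _) _; rewrite mulr_suml; apply: ler_sum => k _.
rewrite normrM -mulrA ler_wpM2l//.
apply: le_trans (fiber_sum_root_weight k N e tB) _.
have t0 : 0 < `|t| by apply: le_lt_trans tB; exact: poly_norm1_ge0.
have d1 : 1 <= `|t| - poly_norm1 p.
  rewrite lerBrDr; apply: ltW; apply: le_lt_trans tB2.
  by rewrite -[leLHS]mul1r ler_wpM2r ?ler1n// ltW ?fiber_bound_gt0.
rewrite -[leRHS]mulr1 -!mulrA ler_wpM2l ?poly_norm1_ge0// mulrA.
apply: ler_pM; rewrite ?mulr_ge0 ?exprn_ge0 ?invr_ge0 ?poly_norm1_ge0//.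
- exact: le_trans d1.
- by rewrite -exprMn lerXn2r ?nnegrE ?divr_ge0 ?poly_norm1_ge0 ?ltW ?fiber_bound_gt0//
     ltr_pM2r ?invr_gt0// /fiber_bound ltrDr ltr01.
- by rewrite invf_le1 // (lt_le_trans ltr01).
Qed.

Lemma fiber_bound_ratio t : 2 * fiber_bound < `|t| -> `|fiber_bound / `|t| | < 1.
Proof.
move=> tB; have b0 := fiber_bound_gt0.
have t0 : 0 < `|t| by apply: lt_trans tB; rewrite mulr_gt0.
rewrite ger0_norm; last by rewrite divr_ge0 // ltW.
rewrite ltr_pdivrMr// mul1r; apply: le_lt_trans tB.
by rewrite -[leLHS]mul1r ler_wpM2r ?ler1n// ltW.
Qed.

Lemma fiber_sum_weight_eventually0 M J t xs :
  (forall j, (J <= j)%N -> moment_coef M j.+1 = 0) ->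
  fiber_list t xs -> 2 * fiber_bound < `|t| ->
  \sum_(x <- xs) weight M x =
  n%:R * M 0 + \sum_(j < J) t^-1 ^+ j.+1 * (moment_coef M j.+1 / j.+1%:R).
Proof.
move=> Mj e tB; have [K K0 KP] := fiber_sum_weight M.
apply/eqP; rewrite -subr_eq0 opprD addrA -normr_le0; apply/ler_addgt0Pr => d d0.
rewrite add0r.
have K1 : 0 < K + 1 by rewrite ltr_wpDl.
have /cvgr_dist_lt/(_ _ (divr_gt0 d0 K1)) := cvg_expc0 (fiber_bound_ratio tB).
move=> [N _ NP]; have {NP}:= NP (N + J)%N (leq_addr _ _).
rewrite /= sub0r normrN normrX => NP.
have := KP t xs (N + J)%N e tB.
rewrite addnC big_split_ord /= addnC [X in _ - (_ + X)]big1 ?addr0 => [|j _]; last first.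
  by rewrite Mj ?leq_addr// mul0r mulr0.
move=> /le_trans; apply.
have r0 : 0 <= (fiber_bound / `|t|) ^+ (N + J).
  by rewrite exprn_ge0// divr_ge0// ltW ?fiber_bound_gt0.
apply: (@le_trans _ _ ((K + 1) * (fiber_bound / `|t|) ^+ (N + J))).
  by rewrite ler_wpM2r// lerDl.
rewrite mulrC -ler_pdivlMr//; apply: le_trans (ltW NP).
rewrite -normrX real_ler_norm//; exact: ger0_real.
Qed.

(** Uniqueness of an asymptotic expansion along an unbounded set: the first possibly nonzero
    coefficient is isolated by truncating one order further. *)
Lemma moment_coef_eq0 M (T : set C) : unbounded_set T ->
  (forall t xs, T t -> fiber_list t xs -> 2 * fiber_bound < `|t| ->
     \sum_(x <- xs) weight M x = n%:R * M 0) ->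
  forall j, moment_coef M j.+1 = 0.
Proof.
move=> Tu TP j; have [m] := ubnP j; elim: m j => // m IH j; rewrite ltnS => jm.
have [K K0 KP] := fiber_sum_weight M.
have b0 := fiber_bound_gt0.
set a := moment_coef M j.+1 / j.+1%:R.
suff a0 : a = 0.
  by move/eqP: a0; rewrite mulf_eq0 invr_eq0 pnatr_eq0 orbF => /eqP.
set b := moment_coef M j.+2 / j.+2%:R.
(* Multiplying the estimate of order [j.+2] by [t ^+ j.+1] leaves [|a| <= A / |t|]. *)
pose A := K * fiber_bound ^+ j.+2 + `|b|.
have A0 : 0 <= A by rewrite addr_ge0// mulr_ge0 ?exprn_ge0// ltW.
apply/eqP; rewrite -normr_le0; apply/ler_addgt0Pr => d d0; rewrite add0r.
have [r rE] : exists r : R, 2 * fiber_bound + A / d = r%:C%C.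
  apply/complex_realP; apply: ger0_real.
  by rewrite addr_ge0 ?mulr_ge0 ?invr_ge0// ltW.
have [t Tt tr] := Tu r; rewrite -rE in tr.
have tB : 2 * fiber_bound < `|t|.
  by apply: le_lt_trans tr; rewrite lerDl mulr_ge0// invr_ge0 ltW.
have t0 : 0 < `|t| by apply: lt_trans tB; rewrite mulr_gt0.
have tn0 : t != 0 by rewrite -normr_gt0.
have [xs e] := fiber_list_exists t.
have := KP t xs j.+2 e tB; rewrite (TP t xs Tt e tB) subrr sub0r normrN.
rewrite 2!big_ord_recr big1 /= ?add0r => [|i _]; last first.
  by rewrite IH ?mul0r ?mulr0// (leq_trans (ltn_ord i)).
rewrite -/a -/b => h.
have aE : a = t ^+ j.+1 * ((t^-1 ^+ j.+1 * a + t^-1 ^+ j.+2 * b) - t^-1 ^+ j.+2 * b).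
  by rewrite addrK mulrA -exprMn divff// expr1n mul1r.
apply: (@le_trans _ _ (A / `|t|)); last first.
  rewrite ler_pdivrMr// mulrC -ler_pdivrMr//; apply: ltW.
  by apply: le_lt_trans tr; rewrite lerDr mulr_ge0// ltW.
rewrite aE normrM; apply: (@le_trans _ _
  (`|t ^+ j.+1| * (K * (fiber_bound / `|t|) ^+ j.+2 + `|t^-1 ^+ j.+2 * b|))).
  by rewrite ler_wpM2l//; apply: le_trans (ler_normB _ _) _; rewrite lerD2r.
rewrite normrM !normrX normfV expr_div_n exprVn (exprS `|t| j.+1).
rewrite le_eqVlt; apply/orP; left; apply/eqP; rewrite /A; have := expf_neq0 j.+1 (lt0r_neq0 t0).
have := lt0r_neq0 t0; move: (`|t| ^+ j.+1) `|t| (_ ^+ j.+2) `|b| => u v w y v0 u0.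
by field; rewrite u0 v0.
Qed.

(** This plays the role of the argument principle. For [M = 1] the weight is the indicator of
    [|x| < 1] and all moment coefficients vanish, so the expansion reduces to its constant [n]. *)
Lemma fiber_count_small t xs : fiber_list t xs -> 2 * fiber_bound < `|t| ->
  count (fun x => `|x| < 1) xs = n.
Proof.
move=> e tB.
pose M : laurent R := [fsfun k in [fset (0 : int)]%fset => 1].
have M0 : M 0 = 1 by rewrite fsfunE inE eqxx.
have fM : finsupp M = [fset (0 : int)]%fset.
  apply/fsetP => k; rewrite mem_finsupp fsfunE !inE.
  by case: (k == 0); rewrite ?oner_neq0 ?eqxx.
have h : \sum_(x <- xs) weight M x = n%:R.
  have Mj j : (0 <= j)%N -> moment_coef M j.+1 = 0.
    by move=> _; rewrite /moment_coef fM big_seq_fset1 mul0r mulr0.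
  by rewrite (fiber_sum_weight_eventually0 Mj e tB) big_ord0 addr0 M0 mulr1.
apply/eqP; rewrite -(@eqr_nat C) -h -sum1_count natr_sum big_mkcond.
apply/eqP; apply: eq_bigr => x _.
rewrite /weight fM big_seq_fset1 M0 mul1r /root_weight /= expr0z.
by case: ifP.
Qed.

End FiberSums.

(** * Functions integral over the polynomials *)

Lemma poly_eq0_unbounded (R : realType) (q : {poly cplx R}) (T : set (cplx R)) :
  unbounded_set T -> (forall t, T t -> q.[t] = 0) -> q = 0.
Proof.
move=> Tu Tq; apply/eqP; apply/negPn/negP => q0.
have [rs qE] := closed_field_poly_normal q.
have [r rE] : exists r : R, \sum_(x <- rs) `|x| = r%:C%C.
  by apply/complex_realP; apply: ger0_real; apply: sumr_ge0.
have [t Tt] := Tu r; rewrite -rE => rt.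
have trs : t \in rs.
  rewrite -root_prod_XsubC -(rootZ _ _ (_ : lead_coef q != 0)) ?lead_coef_eq0//.
  by rewrite -qE; apply/eqP/Tq.
suff : `|t| <= \sum_(x <- rs) `|x| by move=> /(lt_le_trans rt); rewrite ltxx.
by rewrite (big_rem t)//= lerDl sumr_ge0.
Qed.

Section IntegralFunctions.
Variable R : realType.
Local Notation C := (cplx R).

Definition poly_fun (q : {poly C}) : C -> C := fun t => q.[t].

Let poly_fun_additive : additive poly_fun.
Proof. by move=> q q'; apply/funext => t; rewrite /poly_fun hornerD hornerN. Qed.

Let poly_fun_multiplicative : multiplicative poly_fun.
Proof.
by split=> [q q'|]; apply/funext => t; rewrite /poly_fun ?hornerM// hornerC.
Qed.

HB.instance Definition _ :=
  GRing.isAdditive.Build {poly C} (C -> C) poly_fun poly_fun_additive.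
HB.instance Definition _ :=
  GRing.isMultiplicative.Build {poly C} (C -> C) poly_fun poly_fun_multiplicative.

(** No continuity is asked: an equation with polynomial coefficients at each point suffices. *)
Definition integral_fun (f : C -> C) : Prop := integralOver poly_fun f.

Lemma horner_poly_fun m (Q : {poly {poly C}}) (f : C -> C) t :
  (size Q <= m)%N ->
  (map_poly poly_fun Q).[f] t = \sum_(i < m) (Q`_i).[t] * f t ^+ i.
Proof.
move=> Qm; rewrite (@horner_coef_wide _ m); last first.
  exact: leq_trans (size_poly _ _) Qm.
by rewrite fct_sumE; apply: eq_bigr => i _; rewrite coef_map /= mulrfctE exprfctE.
Qed.

Lemma integral_funP (f : C -> C) : integral_fun f ->
  exists d (q : nat -> {poly C}), forall t,
    f t ^+ d + \sum_(i < d) (q i).[t] * f t ^+ i = 0.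
Proof.
move=> [Q Qm /rootP Qf].
exists (size Q).-1, (fun i => Q`_i) => t.
have Q0 : (0 < size Q)%N by rewrite size_poly_gt0 monic_neq0.
have := congr1 (fun g : C -> C => g t) Qf.
have Qs : (size Q <= (size Q).-1.+1)%N by rewrite prednK.
rewrite (horner_poly_fun _ _ Qs) big_ord_recr /=.
by rewrite -/(lead_coef Q) (monicP Qm) hornerC mul1r addrC.
Qed.

Lemma integral_fun_intro (f : C -> C) d (q : nat -> {poly C}) :
  (forall t, f t ^+ d = \sum_(i < d) (q i).[t] * f t ^+ i) -> integral_fun f.
Proof.
move=> fE; pose Q := 'X^d - \poly_(i < d) q i.
have Qm : Q \is monic.
  rewrite monicE /Q lead_coefDl ?lead_coefXn//.
  by rewrite size_polyN size_polyXn ltnS size_poly.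
exists Q => //; apply/rootP; rewrite /Q rmorphB /= map_polyXn hornerD hornerN hornerXn.
apply/eqP; rewrite subr_eq0; apply/eqP/funext => t.
rewrite (horner_poly_fun _ _ (size_poly _ _)) exprfctE fE.
by apply: eq_bigr => i _; rewrite coef_poly ltn_ord.
Qed.

Lemma integral_fun_ext (f g : C -> C) :
  f =1 g -> integral_fun f -> integral_fun g.
Proof. by move=> /funext ->. Qed.

Lemma integral_poly_fun q : integral_fun (poly_fun q).
Proof. exact: integral_id. Qed.

Lemma integral_cst (a : C) : integral_fun (fun=> a).
Proof.
have -> : (fun=> a) = poly_fun a%:P by apply/funext => t; rewrite /poly_fun hornerC.
exact: integral_id.
Qed.

Lemma integral_funD (f g : C -> C) : integral_fun f -> integral_fun g ->
  integral_fun (fun t => f t + g t).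
Proof. exact: integral_add. Qed.

Lemma integral_funM (f g : C -> C) : integral_fun f -> integral_fun g ->
  integral_fun (fun t => f t * g t).
Proof. exact: integral_mul. Qed.

Lemma integral_funX (f : C -> C) n : integral_fun f ->
  integral_fun (fun t => f t ^+ n).
Proof.
move=> fi; elim: n => [|n IH]; first exact: integral_cst.
by under [X in integral_fun X]eq_fun do rewrite exprS; exact: integral_funM.
Qed.

Lemma integral_fun_sum (I : eqType) (s : seq I) (f : I -> C -> C) :
  (forall i, i \in s -> integral_fun (f i)) ->
  integral_fun (fun t => \sum_(i <- s) f i t).
Proof.
elim: s => [_|i s IH fi].
  by under [X in integral_fun X]eq_fun do rewrite big_nil; exact: integral_cst.
under [X in integral_fun X]eq_fun do rewrite big_cons.
apply: integral_funD; first by apply: fi; rewrite mem_head.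
by apply: IH => j js; apply: fi; rewrite in_cons js orbT.
Qed.

Lemma integral_fun_indicator (P : C -> bool) :
  integral_fun (fun t => if P t then 1 else 0).
Proof.
apply: (@integral_fun_intro _ 2 (fun i => (i == 1)%:R)) => t.
rewrite big_ord_recl big_ord1 /= horner0 hornerC mul0r add0r mul1r.
by case: (P t); rewrite ?expr1n // expr0n.
Qed.

(* Clearing the powers of [t^-1] in the equation of integral dependence and putting
   [t = 0] leaves a power of the leading coefficient of [G]. *)
Lemma integral_fun_inv_horner (f : C -> C) (G : {poly C}) (T : set C) :
  integral_fun f -> unbounded_set T -> (forall t, T t -> f t = G.[t^-1]) ->
  (size G <= 1)%N.
Proof.
move=> /integral_funP[d [q qE]] Tu fG; rewrite leqNgt; apply/negP => G1.
set s := (size G).-1; have s0 : (0 < s)%N by rewrite /s; case: (size G) G1 => [|[]].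
have Gs : size G = s.+1 by rewrite /s; case: (size G) G1.
(* [G] with its coefficients reversed, so that [u] at 0 is the leading coefficient of [G]. *)
pose u := \poly_(i < s.+1) G`_(s - i).
have uE t : t != 0 -> u.[t] = t ^+ s * G.[t^-1].
  move=> t0; rewrite horner_poly (horner_coef_wide _ (_ : size G <= s.+1)%N) ?Gs//.
  rewrite mulr_sumr [RHS](reindex_inj rev_ord_inj) /=; apply: eq_bigr => i _.
  have is1 : (i <= s)%N by rewrite -ltnS.
  rewrite subSS mulrCA; congr (_ * _); rewrite -{2}(subnK is1) exprD mulrAC.
  by rewrite -exprMn divff// expr1n mul1r.
pose w := u ^+ d + \sum_(i < d) q i * u ^+ i * 'X^(s * (d - i)).
have w0 : w = 0.
  apply: (poly_eq0_unbounded (T := [set t | T t /\ t != 0])).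
    move=> K; have [t Tt tK] := Tu (Num.max K 0); exists t.
      split=> //; rewrite -normr_gt0; apply: le_lt_trans tK.
      by rewrite (lecR 0) le_max lexx orbT.
    by apply: le_lt_trans tK; rewrite lecR le_max lexx.
  move=> t [Tt t0]; rewrite hornerD horner_exp horner_sum uE// -fG//.
  transitivity (t ^+ s ^+ d * (f t ^+ d + \sum_(i < d) (q i).[t] * f t ^+ i)).
    2: by rewrite qE mulr0.
  rewrite mulrDr -exprMn; congr (_ + _); rewrite mulr_sumr.
  apply: eq_bigr => i _; rewrite !hornerM !horner_exp hornerX uE// -fG//.
  have -> : t ^+ s ^+ d = t ^+ s ^+ i * t ^+ (s * (d - i)).
    by rewrite exprM -exprD subnKC // ltnW.
  by rewrite exprMn; move: (_ ^+ (s * _)) => *; ring.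
have := congr1 (fun v => v.[0]) w0; rewrite horner0 hornerD horner_exp horner_sum.
rewrite big1 => [|i _]; last first.
  rewrite hornerM hornerXn expr0n muln_eq0 subn_eq0 leqNgt ltn_ord orbF gtn_eqF//.
  by rewrite mulr0.
rewrite addr0 horner_coef0 coef_poly /= subn0 => /eqP.
rewrite expf_eq0 => /andP[_]; rewrite -/(lead_coef G) lead_coef_eq0 -size_poly_eq0.
by rewrite Gs.
Qed.

(** * Integrality of the roots and the vanishing of all moment coefficients *)

Section Fiber.
Variables (p : {poly C}) (n : nat).
Hypotheses (n_gt0 : (0 < n)%N) (n_lt : (n < (size p).-1)%N) (p0 : p.[0] != 0).

(** [p - t X^n] has a constant leading coefficient, hence becomes monic over [C[t]]. One more factor
    [X] admits the value 0, which is how cut-off branches are covered. *)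
Lemma integral_fun_root (f : C -> C) :
  (forall t, f t = 0 \/ p.[f t] = t * f t ^+ n) -> integral_fun f.
Proof.
move=> fE; set r := (size p).-1.
have pr : size p = r.+1 by rewrite /r; case: (size p) n_lt.
have l0 := lead_coef_neq0 n_lt.
apply: (@integral_fun_intro _ r.+1 (fun i => if i == 0%N then 0 else
   - (lead_coef p)^-1 *: ((p`_i.-1)%:P - (i.-1 == n)%:R *: 'X))) => t.
rewrite big_ord_recl horner0 mul0r add0r.
have [->|ft] := fE t.
  by rewrite expr0n big1// => i _; rewrite expr0n mulr0.
have : t * f t ^+ n = \sum_(i < r) t * ((i == n :> nat)%:R * f t ^+ i).
  rewrite (bigD1 (Ordinal n_lt))//= eqxx mul1r big1 ?addr0// => i /eqP ni.
  by case: eqP => [e|_]; [case: ni; apply: val_inj|rewrite mul0r mulr0].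
rewrite -ft (@horner_coef_wide _ r.+1) ?pr// big_ord_recr /=.
move/eqP; rewrite addrC -subr_eq0 -addrA addr_eq0 => /eqP e.
rewrite exprSr; apply: (mulfI l0); rewrite mulrA lead_coefE e -sumrB.
rewrite mulNr mulr_suml mulr_sumr -sumrN; apply: eq_bigr => i _.
rewrite /bump leq0n add1n /= hornerZ hornerD hornerN hornerC hornerZ hornerX.
rewrite -lead_coefE exprSr; by field; rewrite ?l0.
Qed.

(** Same argument with the reversed polynomial, whose leading coefficient is the nonzero constant
    [p.[0]] because [0 < n]. *)
Lemma integral_fun_inv_root (f : C -> C) :
  (forall t, f t = 0 \/ p.[(f t)^-1] = t * (f t)^-1 ^+ n) -> integral_fun f.
Proof.
move=> fE; set r := (size p).-1.
have pr : size p = r.+1 by rewrite /r; case: (size p) n_lt.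
apply: (@integral_fun_intro _ r.+1 (fun i => if i == 0%N then 0 else
   - (p.[0])^-1 *: ((p`_(r.+1 - i))%:P - ((r.+1 - i)%N == n)%:R *: 'X))) => t.
rewrite big_ord_recl horner0 mul0r add0r.
have [f0|f0] := eqVneq (f t) 0.
  by rewrite f0 expr0n big1// => i _; rewrite expr0n mulr0.
have [f0'|ft] := fE t; first by rewrite f0' eqxx in f0.
have : t * (f t)^-1 ^+ n = \sum_(i < r) t * ((i.+1 == n :> nat)%:R * (f t)^-1 ^+ i.+1).
  have n1 : (n.-1 < r)%N by apply: leq_ltn_trans n_lt; exact: leq_pred.
  rewrite (bigD1 (Ordinal n1))//= prednK// eqxx mul1r big1 ?addr0// => i /eqP ni.
  case: eqP => [e|_]; last by rewrite mul0r mulr0.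
  by case: ni; apply: val_inj => /=; rewrite -e.
rewrite -ft (@horner_coef_wide _ r.+1) ?pr// big_ord_recl /= expr0 mulr1.
move/eqP; rewrite -subr_eq0 -addrA addr_eq0 => /eqP e.
apply: (mulfI p0); rewrite {1}horner_coef0 e -sumrB.
rewrite mulNr mulr_suml mulr_sumr -sumrN [RHS](reindex_inj rev_ord_inj).
apply: eq_bigr => i _.
rewrite /bump !leq0n !add1n /= hornerZ hornerD hornerN hornerC hornerZ hornerX.
have ir := ltn_ord i.
have -> : (r.+1 - (r - i.+1).+1 = i.+1)%N by lia.
have -> : f t ^+ (r - i.+1).+1 = f t ^+ r.+1 * (f t)^-1 ^+ i.+1.
  have {1}-> : r.+1 = ((r - i.+1).+1 + i.+1)%N by lia.
  by rewrite exprD -mulrA -exprMn divff// expr1n mulr1.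
move: (f t ^+ r.+1) ((f t)^-1 ^+ i.+1) => *.
by field; rewrite ?p0.
Qed.

(** A cut-off power is a power of the cut-off root or of its cut-off inverse; for [k = 0] it is an
    indicator, which is idempotent. *)
Lemma integral_fun_weight (f : C -> C) (M : laurent R) :
  (forall t, f t != 0 /\ p.[f t] = t * f t ^+ n) ->
  integral_fun (fun t => weight M (f t)).
Proof.
move=> fE; apply: integral_fun_sum => k _; apply: integral_funM.
  exact: integral_cst.
rewrite /root_weight; have [k0|k0] := leP 0 k; last first.
  have uE : integral_fun (fun t => if `|f t| < 1 then 0 else (f t)^-1).
    apply: integral_fun_inv_root => t; case: ifP => _; [by left|right].
    by rewrite invrK; have [] := fE t.
  apply: integral_fun_ext (integral_funM (integral_cst (-1)) (integral_funX `|k|%N uE)).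
  move=> t; case: ifP => _.
    by rewrite expr0n; case: (k) k0 => // m _; rewrite mulr0.
  by case: (k) k0 => // m _; rewrite mulN1r NegzE abszN /= exprVn -exprnN.
have [->|k1] := eqVneq k 0.
  by under [X in integral_fun X]eq_fun do rewrite expr0z; exact: integral_fun_indicator.
have uE : integral_fun (fun t => if `|f t| < 1 then f t else 0).
  apply: integral_fun_root => t; case: ifP => _; [right|by left].
  by have [] := fE t.
apply: integral_fun_ext (integral_funX `|k|%N uE).
move=> t; case: ifP => _; case: (k) k0 k1 => // m _ m0.
by rewrite expr0n; case: m m0.
Qed.

Lemma moment_coef_all0 (M : laurent R) J : M 0 = 0 ->
  (forall j, (J <= j)%N -> moment_coef p n M j.+1 = 0) ->
  forall j, moment_coef p n M j.+1 = 0.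
Proof.
move=> M0 MJ.
(* The roots are enumerated independently at each [t], with no regularity in [t]. *)
have /choice[xs xsE] := fiber_list_exists n_lt.
pose F t := \sum_(i <- iota 0 (size p).-1) weight M (nth 0 (xs t) i).
have FE t : F t = \sum_(x <- xs t) weight M x.
  by rewrite /F -(size_fiber n_lt (xsE t)) [RHS](big_nth 0) /index_iota subn0.
have Fi : integral_fun F.
  apply: integral_fun_sum => i; rewrite mem_iota add0n => /andP[_ ir].
  apply: integral_fun_weight => t.
  have xi : nth 0 (xs t) i \in xs t by rewrite mem_nth// (size_fiber n_lt (xsE t)).
  split; first exact: (fiber_neq0 n_gt0 n_lt p0 (xsE t) xi).
  by apply/eqP; rewrite -(mem_fiber n_lt _ (xsE t)).
pose a j := moment_coef p n M j.+1 / j.+1%:R.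
(* [F t = G.[t^-1]] for large [t]; the constant term is 0 because [n * M 0 = 0]. *)
pose G := \poly_(i < J.+1) (if i is j.+1 then a j else 0).
pose T : set C := [set t | 2 * fiber_bound p < `|t|].
have Tu : unbounded_set T.
  move=> K; have [b bE] : exists b : R, 2 * fiber_bound p = b%:C%C.
    by apply/complex_realP; apply: gtr0_real; rewrite mulr_gt0 ?fiber_bound_gt0.
  have m0 : 0 <= Num.max K b + 1.
    have : 0 < b by rewrite -ltcR -bE mulr_gt0 ?fiber_bound_gt0.
    by move=> b0; rewrite addr_ge0// le_max (ltW b0) orbT.
  have tE : `|(Num.max K b + 1)%:C%C : C| = (Num.max K b + 1)%:C%C.
    by rewrite ger0_norm// (lecR 0).
  exists (Num.max K b + 1)%:C%C; rewrite /T /= tE ?bE ltcR ltr_pwDr// le_max lexx ?orbT//.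
have G1 : (size G <= 1)%N.
  apply: (integral_fun_inv_horner Fi Tu) => t Tt; rewrite FE.
  rewrite (fiber_sum_weight_eventually0 n_gt0 n_lt p0 MJ (xsE t) Tt) M0 mulr0 add0r.
  rewrite horner_poly big_ord_recl mul0r add0r; apply: eq_bigr => i _.
  by rewrite /= mulrC.
move=> j; have [Jj|jJ] := leqP J j; first exact: MJ.
have : G`_j.+1 = 0 by rewrite nth_default// (leq_trans G1).
rewrite coef_poly ltnS jJ => /eqP; rewrite mulf_eq0 invr_eq0 pnatr_eq0 orbF.
by move/eqP.
Qed.

End Fiber.
End IntegralFunctions.

(** * Moments as coefficients *)

Section LaurentDerivative.
Variable R : realType.
Local Notation C := (cplx R).

Lemma is_derive_sum_seq (K : numFieldType) (V W : normedModType K) (I : Type)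
    (s : seq I) (h : I -> V -> W) (dh : I -> W) (x v : V) :
  (forall i, is_derive x v (h i) (dh i)) ->
  is_derive x v (fun y => \sum_(i <- s) h i y) (\sum_(i <- s) dh i).
Proof.
move=> hd; elim: s => [|i s IH].
  rewrite big_nil (_ : (fun y => _) = cst 0); first exact: is_derive_cst.
  by apply/funext => y; rewrite big_nil.
rewrite big_cons (_ : (fun y => _) = h i + (fun y => \sum_(j <- s) h j y)).
  exact: is_deriveD.
by apply/funext => y; rewrite big_cons.
Qed.

Lemma is_derive_inv (z : C) : z != 0 ->
  is_derive z 1 (fun y : C => y^-1) (- z ^- 2).
Proof.
move=> z0; have hE : h^-1 *: ((h *: 1 + z)^-1 - z^-1) @[h --> (0 : C)^'] --> - z ^- 2.
  have lim : - ((h + z) * z)^-1 @[h --> (0 : C)^'] --> - z ^- 2.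
    apply: cvgN; rewrite expr2; apply: cvgV; first by rewrite mulf_neq0.
    apply: cvgM; last exact: cvg_cst.
    rewrite -[X in _ --> X]add0r; apply: cvgD; last exact: cvg_cst.
    exact: (cvg_within_filter _ cvg_id).
  apply: cvg_trans lim; apply: near_eq_cvg.
  have nz : 0 < `|z| by rewrite normr_gt0.
  near=> h.
  have h0 : h != 0 by near: h; exact: nbhs_dnbhs_neq.
  have hz : h + z != 0.
    have : `|h| < `|z|.
      near: h; exact: dnbhs0_lt.
    apply: contraTneq => /eqP; rewrite addr_eq0 => /eqP ->.
    by rewrite normrN ltxx.
  by rewrite /GRing.scale /= mulr1; field; rewrite ?h0 ?z0 ?hz.
apply: DeriveDef; first by apply/cvg_ex; exists (- z ^- 2).
exact: (cvg_lim (@norm_hausdorff _ _) hE).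
Unshelve. all: end_near.
Qed.

Lemma is_derive_exprz (z : C) (k : int) : z != 0 ->
  is_derive z 1 (fun y : C => y ^ k) (k%:~R * z ^ (k - 1)).
Proof.
move=> z0; case: k => n.
  have := @is_deriveX _ _ (id : C -> C) n z 1 1 (is_derive_id _ _).
  rewrite (_ : id ^+ n = (fun y : C => y ^ n)); last first.
    by apply/funext => y; rewrite exprfctE.
  rewrite (_ : _ *: 1 = n%:~R * z ^ (n%:Z - 1))// /GRing.scale /= mulr1.
  case: n => [|n]; first by rewrite !mul0r.
  by rewrite /= -addn1 PoszD addrK.
have := is_deriveX n.+1 (is_derive_inv z0).
rewrite (_ : (fun y : C => y^-1) ^+ n.+1 = (fun y : C => y ^ Negz n)); last first.
  by apply/funext => y; rewrite exprfctE exprVn.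
rewrite (_ : _ *: (- z ^- 2) = (Negz n)%:~R * z ^ (Negz n - 1))//.
rewrite /GRing.scale /= NegzE mulrNz mulNr mulrN -mulrA; congr (- (_ * _)).
have -> : - n.+1%:Z - 1 = - (n + 2)%N%:Z by lia.
by rewrite -exprnN exprVn exprD [RHS]invfM.
Qed.

Lemma is_derive_leval (M : laurent R) (z : C) : z != 0 ->
  is_derive z 1 (leval M) (\sum_(k <- finsupp M) M k * (k%:~R * z ^ (k - 1))).
Proof.
move=> z0; apply: is_derive_sum_seq => k.
exact: (is_deriveZ (M k) (is_derive_exprz k z0)).
Qed.

Lemma derivable_leval (M : laurent R) (z : C) : z != 0 -> derivable (leval M) z 1.
Proof. by move=> z0; have [] := is_derive_leval M z0. Qed.

Lemma derive1_leval (M : laurent R) (z : C) : z != 0 ->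
  derive1 (leval M) z = \sum_(k <- finsupp M) M k * (k%:~R * z ^ (k - 1)).
Proof. by move=> z0; rewrite derive1E; have [_ ->] := is_derive_leval M z0. Qed.

End LaurentDerivative.

Section Moments.
Variable R : realType.
Local Notation C := (cplx R).

Lemma cexpiD (x y : R) : cexpi (x + y) = cexpi x * cexpi y.
Proof.
by rewrite /cexpi cosD sinD; apply/eqP; rewrite eq_complex /= eqxx [sin x * _ + _]addrC eqxx.
Qed.

Lemma cexpi0 : cexpi (0 : R) = 1.
Proof. by rewrite /cexpi cos0 sin0. Qed.

Lemma cexpi_neq0 (x : R) : cexpi x != 0.
Proof.
apply/eqP => e; have := cexpiD x (- x); rewrite e mul0r subrr cexpi0 => /eqP.
by rewrite oner_eq0.
Qed.

Lemma cexpi_exprz (x : R) (m : int) : cexpi x ^ m = cexpi (m%:~R * x).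
Proof.
have natE n : cexpi x ^+ n = cexpi (n%:R * x).
  elim: n => [|n IH]; first by rewrite mul0r cexpi0.
  by rewrite exprSr IH -cexpiD -natr1 mulrDl mul1r.
case: m => n; first exact: natE.
have : cexpi (n.+1%:R * x) * cexpi ((Negz n)%:~R * x) = 1.
  by rewrite -cexpiD NegzE mulrNz mulNr subrr cexpi0.
rewrite -natE => e; apply: (mulfI (expf_neq0 n.+1 (cexpi_neq0 x))).
by rewrite e /= divff// expf_neq0// cexpi_neq0.
Qed.

Lemma cexpi_period (m : int) : cexpi (m%:~R * (2 * pi)) = 1 :> C.
Proof.
rewrite -cexpi_exprz (_ : cexpi (2 * pi) = 1) ?exp1rz//.
by rewrite /cexpi mulrC mulr_natr cos2pi sin2pi.
Qed.

Let is_derive_scal (x m : R) : is_derive x 1 (fun y : R => m * y) m.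
Proof.
have h := is_deriveZ m (is_derive_id x (1 : R)).
by rewrite -[m in is_derive _ _ _ m](mulr1 m); exact: h.
Qed.

(** A triple [(a, b, m)] encodes [a cos(m x) + b sin(m x)]. For [m] nonzero its primitive has period
    [2 pi], so only the frequency 0 contributes. *)
Lemma Rintegral_trig_sum (s : seq (R * R * int)) :
  (\int[lebesgue_measure]_(x in `[0, 2 * pi])
    \sum_(c <- s) (c.1.1 * cos (c.2%:~R * x) + c.1.2 * sin (c.2%:~R * x)))%R =
  2 * pi * \sum_(c <- s | c.2 == 0) c.1.1 :> R.
Proof.
set f := fun x : R => \sum_(c <- s) _.
pose G (c : R * R * int) (x : R) : R := if c.2 == 0 then c.1.1 * x else
  c.1.1 / c.2%:~R * sin (c.2%:~R * x) - c.1.2 / c.2%:~R * cos (c.2%:~R * x).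
pose F (x : R) : R := \sum_(c <- s) G c x.
have GE c (x : R) : is_derive x 1 (G c)
    (c.1.1 * cos (c.2%:~R * x) + c.1.2 * sin (c.2%:~R * x)).
  have lin m := is_derive_scal x m.
  rewrite /G; case: eqP => [->|/eqP c0].
    by rewrite !mul0r cos0 sin0 mulr1 mulr0 addr0; exact: lin.
  have c0' : c.2%:~R != 0 :> R by rewrite intr_eq0.
  have ds := is_derive1_comp (is_derive_sin (c.2%:~R * x)) (lin c.2%:~R).
  have dc := is_derive1_comp (is_derive_cos (c.2%:~R * x)) (lin c.2%:~R).
  apply: is_derive_eq (is_deriveB (is_deriveZ (c.1.1 / c.2%:~R) ds)
                                  (is_deriveZ (c.1.2 / c.2%:~R) dc)) _.
  by rewrite /GRing.scale /=; field.
have FE (x : R) : is_derive x 1 F (f x) by exact: is_derive_sum_seq.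
have Fc (x : R) : {for x, continuous F}.
  by apply/differentiable_continuous/derivable1_diffP; have [] := FE x.
have fc : continuous f.
  move=> x; have fd : derivable f x 1.
    have cd c : is_derive x 1 (fun y : R => c.1.1 * cos (c.2%:~R * y) + c.1.2 * sin (c.2%:~R * y))
        (c.1.1 *: (- sin (c.2%:~R * x) * c.2%:~R) + c.1.2 *: (cos (c.2%:~R * x) * c.2%:~R)).
      have lin := is_derive_scal x c.2%:~R.
      exact: (is_deriveD
        (is_deriveZ c.1.1 (is_derive1_comp (is_derive_cos (c.2%:~R * x)) lin))
        (is_deriveZ c.1.2 (is_derive1_comp (is_derive_sin (c.2%:~R * x)) lin))).
    by have [] := is_derive_sum_seq s cd.
  exact/differentiable_continuous/derivable1_diffP.
have pi2 : 0 < 2 * pi :> R by rewrite mulr_gt0// pi_gt0.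
rewrite /Rintegral (continuous_FTC2 (F := F) pi2).
- rewrite -EFinB /= /F -sumrB [in RHS]big_mkcond mulr_sumr; apply: eq_bigr => c _.
  rewrite /G; case: eqP => [_|_]; first by rewrite mulr0 subr0 mulrC.
  have := cexpi_period c.2 => /eqP; rewrite eq_complex /= => /andP[/eqP -> /eqP ->].
  by rewrite !mulr0 sin0 cos0 !mulr0 subrr.
- exact: continuous_subspaceT.
- split; first by move=> x _; have [] := FE x.
    exact/cvg_at_right_filter/Fc.
  exact/cvg_at_left_filter/Fc.
- by move=> x _; rewrite derive1E; have [_ ->] := FE x.
Qed.

Lemma circle_integral_sum (g : C -> C) (s : seq (C * int)) :
  (forall x : R, g (cexpi x) * ((0 +i* 1)%C * cexpi x) =
     \sum_(c <- s) c.1 * cexpi (c.2%:~R * x)) ->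
  circle_integral g = (2 * pi)%:C%C * \sum_(c <- s | c.2 == 0) c.1.
Proof.
move=> gE; rewrite /circle_integral.
have ReE x : complex.Re (g (cexpi x) * ((0 +i* 1)%C * cexpi x)) =
  \sum_(c <- [seq (complex.Re c.1, - complex.Im c.1, c.2) | c <- s])
     (c.1.1 * cos (c.2%:~R * x) + c.1.2 * sin (c.2%:~R * x)).
  rewrite gE (raddf_sum (@complex.Re R)) big_map; apply: eq_bigr => c _.
  by case: c => -[a b] m /=; rewrite mulNr.
have ImE x : complex.Im (g (cexpi x) * ((0 +i* 1)%C * cexpi x)) =
  \sum_(c <- [seq (complex.Im c.1, complex.Re c.1, c.2) | c <- s])
     (c.1.1 * cos (c.2%:~R * x) + c.1.2 * sin (c.2%:~R * x)).
  rewrite gE (raddf_sum (@complex.Im R)) big_map; apply: eq_bigr => c _.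
  by case: c => -[a b] m /=; rewrite addrC.
under eq_Rintegral => x _ do rewrite ReE.
under [X in (_ +i* X)%C]eq_Rintegral => x _ do rewrite ImE.
rewrite !Rintegral_trig_sum !big_map /=.
rewrite -(raddf_sum (@complex.Re R)) -(raddf_sum (@complex.Im R)).
by case: (\sum_(c <- s | _) c.1) => a b; apply/eqP; rewrite eq_complex /= !mul0r subr0 addr0 !eqxx.
Qed.

Lemma momentE (L M : laurent R) i : moment L M i =
  (2 * pi)%:C%C * (0 +i* 1)%C * moment_coef (lnumer L) (pole_order0 L) M i.
Proof.
set p := lnumer L; set n := pole_order0 L; set q := p ^+ i.
(* Pairs of coefficient and frequency. The [z] in [dz = i z dx] cancels the shift of exponent in
   [M'], so frequency 0 means [a = n i - k], the index read by [lcoef i (- k)]. *)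
pose s : seq (C * int) := [seq ((0 +i* 1)%C * (M c.1 * (c.1%:~R * q`_c.2)),
    c.1 + c.2%:Z - (n * i)%N%:Z) | c <- [seq (k, a) | k <- finsupp M, a <- iota 0 (size q)]].
rewrite /moment (circle_integral_sum (s := s)); last first.
  move=> x; have e0 := cexpi_neq0 x.
  rewrite /s big_map big_allpairs_dep /= derive1_leval// lnumerE// expr_div_n -/p -/n.
  rewrite -horner_exp -/q mulr_sumr mulr_suml; apply: eq_bigr => k _.
  rewrite -{1}(subn0 (size q)) -/(index_iota 0 (size q)) big_mkord horner_coef.
  rewrite !mulr_suml; apply: eq_bigr => a _.
  rewrite -cexpi_exprz !expfzDr// -exprnN -exprnP -exprM exprN1.
  have := expf_neq0 (n * i) e0.
  move: (cexpi x ^+ (n * i)) (cexpi x ^ k) (cexpi x ^+ a) (0 +i* 1)%C (M k) (k%:~R)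
    (q`_a) (cexpi x) e0.
  move=> A B D E G H I J J0 A0; field; rewrite ?A0 ?J0//.
rewrite -mulrA; congr (_ * _); rewrite /moment_coef /s big_map big_mkcond big_allpairs_dep /=.
rewrite mulr_sumr; apply: eq_bigr => k _; rewrite -big_mkcond /=.
rewrite -big_distrr /= -big_distrr /= -big_distrr /=; do 3!congr (_ * _).
rewrite /lcoef -/q; case: ifPn => [k0|k0].
  have [qs|qs] := leqP (size q) (absz (- k + (n * i)%N%:Z)).
    rewrite (nth_default _ qs) big_seq_cond big1// => a.
    rewrite mem_iota add0n => /andP[/andP[_ aq] /eqP ka].
    have : (size q <= a)%N by apply: (leq_trans qs); rewrite -ltnS; lia.
    by rewrite leqNgt aq.
  set a0 := absz _ in qs *.
  have a0q : a0 \in iota 0 (size q) by rewrite mem_iota.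
  have a0E : k + a0%:Z - (n * i)%N%:Z == 0 by apply/eqP; rewrite /a0; lia.
  rewrite big_mkcond (bigD1_seq a0 a0q (iota_uniq _ _)) /= a0E big1 ?addr0// => a aa.
  by case: eqP => // ka; case/eqP: aa; rewrite /a0; lia.
rewrite big_pred0// => a; apply/negbTE; move: k0; rewrite -ltNge.
by move=> k0; apply/eqP; lia.
Qed.

End Moments.

(** * The identity theorem for integral functions *)

(** The part of [A] where [P] holds is open and closed in [A]. It serves below for segments, for
    parameters of paths and for domains. *)
Lemma connected_locally_constant (T : topologicalType) (A P : set T) :
  connected A -> (forall x, A x -> \forall y \near within A (nbhs x), P y <-> P x) ->
  forall x y, A x -> A y -> P x -> P y.
Proof.
move=> Ac AP x y Ax Ay Px.
suff e : A `&` P = A by move: Ay; rewrite -e => -[].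
apply: Ac; first by exists x.
  exists [set z | nbhs z (fun y => A y -> P y)].
    rewrite openE => z /=; rewrite /interior /= => h.
    exact: nbhs_interior h.
  apply/seteqP; split=> z [Az h]; split=> //=.
    have := AP z Az; apply: filterS => w wz; exact/wz.
  by have := nbhs_singleton h; exact.
exists (~` [set z | nbhs z (fun y => A y -> ~ P y)]).
  apply: open_closedC; rewrite openE => z /=; rewrite /interior /= => h.
  exact: nbhs_interior h.
apply/seteqP; split=> z [Az h]; split=> //=.
  by move=> h'; have := nbhs_singleton h'; exact.
apply: contrapT => Pz; apply: h.
have := AP z Az; apply: filterS => w wz /wz; exact: Pz.
Qed.

Section ComplexContinuity.
Variable R : realType.
Local Notation C := (cplx R).

Lemma cvg_horner_comp (T : Type) (F : set_system T) (FF : Filter F)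
    (q : {poly C}) (f : T -> C) (l : C) :
  f s @[s --> F] --> l -> q.[f s] @[s --> F] --> q.[l].
Proof.
move=> fl; elim/poly_ind: q => [|q c IH].
  under eq_cvg do rewrite horner0; rewrite horner0; exact: cvg_cst.
under eq_cvg do rewrite hornerD hornerM hornerX hornerC.
rewrite hornerD hornerM hornerX hornerC.
exact: (cvgD (cvgM IH fl) (cvg_cst c)).
Qed.

Lemma cvg_exp_comp (T : Type) (F : set_system T) (FF : Filter F)
    (n : nat) (f : T -> C) (l : C) :
  f s @[s --> F] --> l -> f s ^+ n @[s --> F] --> l ^+ n.
Proof.
move=> fl; have := cvg_horner_comp FF (q := 'X^n) fl.
by under eq_cvg do rewrite hornerXn; rewrite hornerXn.
Qed.

Lemma cvg_sum_comp (T : Type) (F : set_system T) (FF : Filter F) (I : Type)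
    (s : seq I) (f : I -> T -> C) (l : I -> C) :
  (forall i, f i x @[x --> F] --> l i) ->
  \sum_(i <- s) f i x @[x --> F] --> \sum_(i <- s) l i.
Proof.
move=> fl; apply: cvg_big => [|i _]; [exact: add_continuous|exact: fl].
Qed.

Lemma cvg_real_complex (a : R) : (x%:C%C : C) @[x --> a] --> (a%:C%C : C).
Proof.
apply/cvgrPdist_lt => e e0.
have [d ed] : exists d : R, e = d%:C%C.
  by apply/complex_realP; exact: gtr0_real.
have d0 : 0 < d by rewrite -ltcR -ed.
have /cvgr_dist_lt/(_ _ d0) : x @[x --> a] --> a by exact: cvg_id.
apply: filterS => x ax; rewrite ed -rmorphB normc_def /= expr0n addr0 sqrtr_sqr.
by rewrite ltcR.
Qed.

Lemma cvg_segment (u v t : C) (a : R) :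
  t + (x%:C%C * u + (1 - x)%:C%C * v) @[x --> a] -->
  t + (a%:C%C * u + (1 - a)%:C%C * v).
Proof.
have h : (1 - x)%:C%C @[x --> a] --> ((1 - a)%:C%C : C).
  have e (x : R) : (1 - x)%:C%C = 1 - x%:C%C :> C by rewrite rmorphB rmorph1.
  under eq_cvg do rewrite e; rewrite e.
  exact: (cvgB (cvg_cst (1 : C)) (cvg_real_complex (a := a))).
exact: (cvgD (cvg_cst t) (cvgD (cvgM (cvg_real_complex (a := a)) (cvg_cst u))
                               (cvgM h (cvg_cst v)))).
Qed.

(* The segment from [s] to [s'] may meet [t]; turning [s] slightly around [t]
   then avoids it. *)
Lemma perturb_segment (u v : C) (d : R) : u != 0 -> v != 0 -> d != 0 ->
  (forall a : R, a%:C%C * u + (1 - a)%:C%C * v != 0) \/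
  (forall a : R, a%:C%C * ((1 +i* d)%C * u) + (1 - a)%:C%C * v != 0).
Proof.
move=> u0 v0 d0; have [h|/existsNP[a /negP/negPn/eqP av]] :=
  pselect (forall a : R, a%:C%C * u + (1 - a)%:C%C * v != 0); first by left.
right=> b; apply/eqP => bv.
have a1 : (1 - a)%:C%C != 0 :> C.
  apply/eqP => a1; move: av; rewrite a1 mul0r addr0 => /eqP.
  rewrite mulf_eq0 (negPf u0) orbF => /eqP a0; move: a1.
  by rewrite rmorphB /= a0 subr0 => /eqP; rewrite oner_eq0.
(* If the straight segment meets 0, then [v] is a real multiple of [u], hence not of
   [(1 + i d) u]. *)
have vE : v = - (a%:C%C / (1 - a)%:C%C * u).
  apply: (mulfI a1); have -> : (1 - a)%:C%C * v = - (a%:C%C * u).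
    by apply/eqP; rewrite -addr_eq0 addrC av.
  by rewrite mulrN mulrA mulrCA divff ?mulr1.
have : b%:C%C * (1 +i* d)%C = (1 - b)%:C%C * (a%:C%C / (1 - a)%:C%C) :> C.
  apply: (mulIf u0); apply/eqP; rewrite -subr_eq0 -[X in _ == X]bv vE; apply/eqP; ring.
rewrite -fmorphV -!rmorphM /= => /eqP; rewrite eq_complex /= => /andP[_ /eqP].
rewrite mul0r addr0 => /eqP; rewrite mulf_eq0 (negPf d0) orbF => /eqP b0.
move: bv; rewrite b0 subr0 mul0r add0r rmorph1 mul1r => /eqP.
by rewrite (negPf v0).
Qed.

End ComplexContinuity.

Section IdentityTheorem.
Variable R : realType.
Local Notation C := (cplx R).
Local Notation I01 := (`[0, 1]%classic : set R).

Lemma cvg_horner_at (q : {poly C}) (t : C) : (horner q : C -> C) @ t --> (q.[t] : C).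
Proof.
have h : (s : C) @[s --> t] --> t by exact: cvg_id.
exact: (cvg_horner_comp _ (q := q) (f := fun s => s) h).
Qed.

Lemma cvg_near_neq0 (f : C -> C) (t l : C) :
  f s @[s --> t] --> l -> l != 0 -> \forall s \near t, f s != 0.
Proof. move=> fl l0; exact: (@cvgr_neq0 _ _ _ (nbhs t) _ f l fl l0). Qed.

Lemma near_ball (t e s : C) : 0 < e -> ball t e s -> \forall z \near s, ball t e z.
Proof.
move=> e0 ts; apply: open_nbhs_nbhs; split; [exact: ball_open|exact: ts].
Qed.

Lemma near_punctured_exists (t : C) (P : set C) :
  (\forall y \near t, P y) -> exists2 y, y != t & P y.
Proof.
move=> /nbhs_ballP[e /= e0 eP]; exists (t + e / 2).
  by rewrite -subr_eq0 addrAC subrr add0r mulf_neq0 ?invr_eq0 ?pnatr_eq0 ?gt_eqF.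
apply: eP; rewrite -ball_normE /ball_ /= opprD addrA subrr sub0r normrN.
by rewrite gtr0_norm ?divr_gt0// gtr_pMr// invf_lt1// ltr1n.
Qed.

Lemma near_poly_neq0 (q : {poly C}) (t : C) : q != 0 ->
  \forall s \near t, s != t -> q.[s] != 0.
Proof.
move=> q0; have [m [q' qt qE]] := multiplicity_XsubC q t.
rewrite q0 /= in qt.
have h := cvg_horner_at (q := q') (t := t).
have q't : q'.[t] != 0 by [].
have := cvg_near_neq0 h q't; apply: filterS => s qs st.
by rewrite qE hornerM mulf_neq0// horner_exp hornerXsubC expf_neq0// subr_eq0.
Qed.

(** [Phi] may vanish at some points, so the power that is split off cannot be cancelled and is kept
    as a factor. *)
Lemma integral_lowest_coef (Phi : C -> C) (V : set C) m (q : nat -> {poly C}) k :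
  q m != 0 ->
  (forall t, V t -> Phi t ^+ k * \sum_(i < m.+1) (q i).[t] * Phi t ^+ i = 0) ->
  exists k m (q' : nat -> {poly C}), q' 0%N != 0 /\ forall t, V t ->
    Phi t ^+ k * \sum_(i < m.+1) (q' i).[t] * Phi t ^+ i = 0.
Proof.
elim: m q k => [|m IH] q k qm qP; first by exists k, 0%N, q.
have [q0|q0] := eqVneq (q 0%N) 0; last by exists k, m.+1, q.
apply: (IH (fun i => q i.+1) k.+1) => // t Vt.
rewrite -[RHS](qP t Vt) exprSr -mulrA; congr (_ * _).
rewrite [RHS]big_ord_recl q0 horner0 mul0r add0r mulr_sumr.
by apply: eq_bigr => i _; rewrite lift0 exprS mulrCA.
Qed.

Variables (Phi g : C -> C) (V : set C).
Hypothesis Vo : open V.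
Hypothesis Phic : forall t, V t -> Phi s @[s --> t] --> Phi t.
Hypothesis gi : integral_fun g.
Hypothesis gE : forall t, V t -> g t = Phi t.

(* Dividing the equation of [Phi] by its lowest power of [Phi] leaves a nonzero
   constant coefficient [q]; where [q] does not vanish, [Phi] cannot take small
   nonzero values. *)
Lemma integral_zero_locally_constant : exists2 q : {poly C}, q != 0 &
  forall t, V t -> q.[t] != 0 -> \forall s \near t, Phi s = 0 <-> Phi t = 0.
Proof.
have [d [q0 q0P]] := integral_funP gi.
have [k [m [q [q00 qP]]]] : exists k m (q' : nat -> {poly C}), q' 0%N != 0 /\
    forall t, V t -> Phi t ^+ k * \sum_(i < m.+1) (q' i).[t] * Phi t ^+ i = 0.
  apply: (@integral_lowest_coef _ _ d (fun i => if i == d then 1 else q0 i) 0).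
    by rewrite eqxx oner_neq0.
  move=> t Vt; rewrite expr0 mul1r -[RHS](q0P t) big_ord_recr /= eqxx hornerC mul1r addrC gE//.
  by congr (_ + _); apply: eq_bigr => i _; rewrite ltn_eqF.
exists (q 0%N) => // t Vt qt.
have Vnear : \forall s \near t, V s by exact: open_nbhs_nbhs.
have [Pt|Pt] := eqVneq (Phi t) 0; last first.
  have := cvg_near_neq0 (Phic Vt) Pt; apply: filterS => s /negPf Ps.
  by split=> /eqP; rewrite ?Ps// (negPf Pt).
have h : \sum_(i <- index_enum 'I_m.+1) (q i).[s] * Phi s ^+ i @[s --> t] -->
         \sum_(i <- index_enum 'I_m.+1) (q i).[t] * Phi t ^+ i.
  apply: (@cvg_sum_comp R C (nbhs t) (nbhs_filter t)) => i.
  have hq := cvg_horner_at (q := q i) (t := t).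
  exact: (cvgM hq (cvg_exp_comp _ (n := i) (Phic Vt))).
have ht : \sum_(i <- index_enum 'I_m.+1) (q i).[t] * Phi t ^+ i != 0.
  rewrite big_ord_recl expr0 mulr1 big1 ?addr0// => i _.
  by rewrite Pt expr0n mulr0.
have := cvg_near_neq0 h ht; move: Vnear; apply: filterS2 => s Vs Ss; split=> // _.
have /eqP := qP s Vs; rewrite mulf_eq0 (negPf Ss) orbF.
by rewrite expf_eq0 => /andP[_ /eqP].
Qed.

Lemma integral_zero_segment (q : {poly C}) (t u v : C) :
  (forall t, V t -> q.[t] != 0 -> \forall s \near t, Phi s = 0 <-> Phi t = 0) ->
  (forall a : R, I01 a -> V (t + (a%:C%C * u + (1 - a)%:C%C * v)) /\
     q.[t + (a%:C%C * u + (1 - a)%:C%C * v)] != 0) ->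
  Phi (t + u) = 0 -> Phi (t + v) = 0.
Proof.
move=> qP segP Pu.
pose P := [set a : R | Phi (t + (a%:C%C * u + (1 - a)%:C%C * v)) = 0].
have I0 : I01 0 by rewrite /= in_itv /= lexx ler01.
have I1 : I01 1 by rewrite /= in_itv /= lexx ler01.
have P1 : P 1 by rewrite /P /= subrr rmorph1 rmorph0 mul1r mul0r addr0.
have := connected_locally_constant (P := P) (@segment_connected R 0 1) _ I1 I0 P1.
move=> h; suff : P 0 by rewrite /P /= subr0 rmorph1 rmorph0 mul1r mul0r add0r.
apply: h => a Ia; apply: cvg_within.
have [Va qa] := segP a Ia.
exact: (cvg_segment (u := u) (v := v) (t := t) (a := a)) (qP _ Va qa).
Qed.

(** On a small ball [q] vanishes at most at the centre [t]. Zeros propagate along segments that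
    avoid [t], and continuity settles the value at [t]. *)
Lemma integral_identity_local (t : C) : V t ->
  \forall s \near t, (\forall z \near s, Phi z = 0) <-> (\forall z \near t, Phi z = 0).
Proof.
move=> Vt; have [q q0 qP] := integral_zero_locally_constant.
have Vnear : \forall s \near t, V s by exact: open_nbhs_nbhs.
have := near_poly_neq0 t q0 => qnear.
have /nbhs_ballP[e /= e0 eP] : \forall s \near t, V s /\ (s != t -> q.[s] != 0).
  by move: Vnear qnear; apply: filterS2.
have ballE (y : C) : ball t e y = (`|t - y| < e) :> Prop by rewrite -ball_normE.
have claim0 s y : ball t e s -> s != t -> (\forall z \near s, Phi z = 0) ->
    ball t e y -> y != t -> Phi y = 0.
  move=> ts st sP ty yt.
  have u0 : s - t != 0 by rewrite subr_eq0.
  have v0 : y - t != 0 by rewrite subr_eq0.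
  have sball : \forall z \near s, ball t e z.
    exact: near_ball.
  have /nbhs_ballP[e1 /= e10 e1P] : \forall z \near s, Phi z = 0 /\ ball t e z.
    by move: sP sball; apply: filterS2.
  (* Turning by [1 + i d] moves [s] by [d |s - t| = e1 / 2], so it stays where [Phi] is known to
     vanish. *)
  have [d dE] : exists d : R, e1 / (2 * `|s - t|) = d%:C%C.
    by apply/complex_realP; apply: gtr0_real; rewrite divr_gt0// mulr_gt0// normr_gt0.
  have d0 : 0 < d by rewrite -ltcR -dE divr_gt0// mulr_gt0// normr_gt0.
  have seg (u : C) : Phi (t + u) = 0 -> ball t e (t + u) ->
      (forall a : R, a%:C%C * u + (1 - a)%:C%C * (y - t) != 0) -> Phi y = 0.
    move=> Pu tu avoid; have -> : y = t + (y - t) by rewrite addrC subrK.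
    apply: (integral_zero_segment qP _ Pu) => a; rewrite /= in_itv /= => /andP[a0 a1].
    have /eP[? qa] : ball t e (t + (a%:C%C * u + (1 - a)%:C%C * (y - t))).
      move: tu ty; rewrite !ballE !opprD !addrA subrr !sub0r !normrN => tu ty.
      rewrite -opprD normrN; apply: le_lt_trans (ler_normD _ _) _.
      have aC : 0 <= a%:C%C :> C by rewrite (lecR 0).
      have bC : 0 <= (1 - a)%:C%C :> C by rewrite (lecR 0) subr_ge0.
      rewrite !normrM (ger0_norm aC) (ger0_norm bC).
      have -> : e = a%:C%C * e + (1 - a)%:C%C * e.
        by rewrite -mulrDl -rmorphD /= addrC subrK mul1r.
      have ty' : `|y - t| < e by rewrite distrC.
      have [aa|] := eqVneq a 0.
        by rewrite aa subr0 rmorph0 rmorph1 !mul0r !add0r !mul1r.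
      move=> a0'; apply: ltr_leD.
        by rewrite ltr_pM2l// (ltcR 0) lt_neqAle eq_sym a0'.
      by rewrite ler_wpM2l// ltW.
    split=> //; apply: qa; apply: contra_neq (avoid a) => /eqP.
    by rewrite -subr_eq0 addrAC subrr add0r => /eqP.
  have [avoid|avoid] := perturb_segment u0 v0 (lt0r_neq0 d0).
    apply: (seg (s - t)) => //; rewrite addrC subrK//.
    exact: nbhs_singleton sP.
  have [] := e1P (t + (1 +i* d)%C * (s - t)).
    rewrite -ball_normE /ball_ /=.
    have -> : s - (t + (1 +i* d)%C * (s - t)) = - ((0 +i* 1)%C * d%:C%C * (s - t)).
      have -> : (1 +i* d)%C = 1 + (0 +i* 1)%C * d%:C%C.
        by apply/eqP; rewrite eq_complex /=; apply/andP; split; apply/eqP; ring.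
      ring.
    rewrite normrN normrM normrM -dE.
    have -> : `|(0 +i* 1)%C : C| = 1.
      by rewrite normc_def /= expr0n expr1n add0r sqrtr1.
    rewrite mul1r gtr0_norm; last by rewrite divr_gt0// mulr_gt0// normr_gt0.
    rewrite invfM mulrA mulfVK ?normr_eq0//.
    by rewrite gtr_pMr// invf_lt1// ltr1n.
  by move=> Pu tu; exact: seg Pu tu avoid.
have claim s y : ball t e s -> (\forall z \near s, Phi z = 0) -> ball t e y -> Phi y = 0.
  move=> ts sP ty.
  have sball : \forall z \near s, ball t e z.
    exact: near_ball.
  (* If the zero germ sits at [t] itself, a nearby point also carries one. *)
  have [s1 [ts1 s1t s1P]] : exists s1, [/\ ball t e s1, s1 != t & \forall z \near s1, Phi z = 0].
    have [st|st] := eqVneq s t; last by exists s.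
    have : \forall z \near s, ball t e z /\ (\forall w \near z, Phi w = 0).
      by move: sball (nbhs_interior sP); apply: filterS2.
    by move=> /near_punctured_exists[s1]; rewrite st => s1t [? ?]; exists s1.
  have [yt|yt] := eqVneq y t; last exact: claim0 ts1 s1t s1P ty yt.
  (* A nonzero value at [t] would persist at some nearby [z] different from [t], against
     [claim0]. *)
  rewrite yt; apply/eqP/negPn/negP => Pt.
  have tball : \forall z \near t, ball t e z by exact: nbhsx_ballx.
  have : \forall z \near t, Phi z != 0 /\ ball t e z.
    by move: (cvg_near_neq0 (Phic Vt) Pt) tball; apply: filterS2.
  move=> /near_punctured_exists[z zt [Pz tz]].
  by move: Pz; rewrite (claim0 s1 z)// eqxx.
have tball : \forall z \near t, ball t e z by exact: nbhsx_ballx.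
move: (tball); apply: filterS => s ts; split=> sP.
  by move: tball; apply: filterS => z; exact: claim ts sP.
have : \forall z \near s, ball t e z.
  exact: near_ball.
by apply: filterS => z; apply: claim sP; exact: ballxx.
Qed.

Lemma integral_identity (t1 t2 : C) : connected V -> V t1 -> V t2 ->
  (\forall z \near t1, Phi z = 0) -> \forall z \near t2, Phi z = 0.
Proof.
move=> Vc Vt1 Vt2; apply: (connected_locally_constant
  (P := [set t | \forall z \near t, Phi z = 0]) Vc _ Vt1 Vt2) => t Vt.
apply: cvg_within; exact: integral_identity_local Vt.
Qed.

End IdentityTheorem.

(** * Branches of the inverse of a proper Laurent polynomial *)

Section ProperLaurent.
Variable R : realType.
Local Notation C := (cplx R).
Variable L : laurent R.
Hypothesis hL : lproper L.
Local Notation p := (lnumer L).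
Local Notation n := (pole_order0 L).

Lemma coef_lnumer (m : nat) : p`_m = L (m%:Z - n%:Z).
Proof.
rewrite /lnumer coef_sum.
under eq_big_seq => k kL.
  rewrite coefZ coefXn (_ : (m == _) = (k == m%:Z - n%:Z)); last first.
    by have := finsupp_ge_pole_order0 kL; lia.
  over.
have [i|/fsfun_dflt L0] := boolP (m%:Z - n%:Z \in finsupp L).
  rewrite (big_rem _ i)/= eqxx mulr1 big_seq big1 ?addr0// => k.
  by rewrite (rem_filter _ (fset_uniq _)) mem_filter => /andP[/negPf /= -> _]; rewrite mulr0.
by rewrite L0 big1// => k _; case: eqP => [->|_]; rewrite ?L0 ?mul0r ?mulr0.
Qed.

Lemma lproper_pole_gt0 : (0 < n)%N.
Proof.
rewrite lt0n; apply/negP => /eqP n0; case: hL => nneg _; apply: nneg => k k0.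
apply/eqP; have [kL|] := boolP (k \in finsupp L); last by rewrite mem_finsupp negbK.
by have := finsupp_ge_pole_order0 kL; rewrite n0; lia.
Qed.

Lemma lproper_pole_lt : (n < (size p).-1)%N.
Proof.
rewrite ltnNge; apply/negP => pn; case: hL => _; apply=> k k0.
have -> : k = (absz k + n)%N%:Z - n%:Z by lia.
rewrite -coef_lnumer nth_default//; apply: leq_trans (leqSpred _) _.
by apply: leq_ltn_trans pn _; lia.
Qed.

Lemma lproper_numer0 : p.[0] != 0.
Proof.
have := lnumer_coprime L; rewrite coprimep_pexpr ?lproper_pole_gt0//.
by rewrite coprimepX.
Qed.

Lemma ldegree_lproper : ldegree L = (size p).-1.
Proof. by apply/maxn_idPl/ltnW; exact: lproper_pole_lt. Qed.

Lemma leval_eqP (z t : C) : z != 0 ->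
  (leval L z = t) <-> (p.[z] = t * z ^+ n).
Proof.
move=> z0; have zn := expf_neq0 n z0; rewrite lnumerE//; split=> [<-|->].
  by rewrite divfK.
by rewrite mulfK.
Qed.

(** The left side is the derivative at [z] of [p - t X^n] for [t = L z]: a noncritical point is a
    simple root of its fiber polynomial. *)
Lemma deriv_fiber (z : C) : z != 0 ->
  p^`().[z] - leval L z * (z ^+ n.-1 *+ n) = derive1 (leval L) z * z ^+ n.
Proof.
move=> z0; rewrite derive1_leval// /lnumer [X in X.[z]]raddf_sum horner_sum /leval.
rewrite !mulr_suml -sumrB.
apply: eq_big_seq => k kL; rewrite /= derivZ derivXn hornerZ hornerMn hornerXn.
have kn := finsupp_ge_pole_order0 kL; set m := absz _.
have mE : k = m%:Z - n%:Z by rewrite /m; lia.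
have zn := expf_neq0 n z0.
have mm : z ^+ m.-1 *+ m = m%:R * z ^+ m / z.
  case: (m) => [|m']; first by rewrite mulr0n !mul0r.
  by rewrite -mulr_natl exprS; field.
have nn : z ^+ n.-1 *+ n = n%:R * z ^+ n / z.
  case: (n) => [|m']; first by rewrite mulr0n !mul0r.
  by rewrite -mulr_natl exprS; field.
rewrite mm nn mE !expfzDr// exprN1 -exprnN -!exprnP intrB -!pmulrn.
move: (L _) (z ^+ m) (z ^+ n) zn (m%:R) (n%:R) => a b c c0 d e.
by field; rewrite ?z0 ?c0.
Qed.

(** The branch and its inverse are extended by 0 outside [V], a value that the integrality lemmas
    allow. *)
Lemma integral_leval (M : laurent R) (V : set C) (h : C -> C) :
  (forall t, V t -> h t != 0 /\ leval L (h t) = t) ->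
  exists2 g, integral_fun g & forall t, V t -> g t = leval M (h t).
Proof.
move=> hV.
pose u t := if `[< V t >] then h t else 0.
pose v t := if `[< V t >] then (h t)^-1 else 0.
have ui : integral_fun u.
  apply: (integral_fun_root lproper_pole_lt) => t; rewrite /u.
  by case: asboolP => [/hV[h0 /leval_eqP]|_]; [right; auto|left].
have vi : integral_fun v.
  apply: (integral_fun_inv_root lproper_pole_gt0 lproper_pole_lt lproper_numer0) => t.
  rewrite /v; case: asboolP => [/hV[h0 /leval_eqP]|_]; [right|by left].
  by rewrite invrK; auto.
exists (fun t => \sum_(k <- finsupp M) M k *
    (if 0 <= k then u t ^+ `|k|%N else v t ^+ `|k|%N)).
  apply: integral_fun_sum => k _; apply: integral_funM; first exact: integral_cst.
  by case: (0 <= k); exact: integral_funX.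
move=> t Vt; apply: eq_bigr => k _; congr (_ * _).
rewrite /u /v asboolT//; case: k => k //=.
by rewrite exprVn.
Qed.

(** Stated for germs: since [D] is entire, continuation transports the relation with the same
    [D]. *)
Definition branch_relation (I : finType) (M : laurent R) (a : I -> C)
    (h : I -> C -> C) (D : {poly C}) (t : C) : Prop :=
  \forall z \near t, \sum_i a i * leval M (h i z) = D.[z].

(** Of a holomorphic branch only continuity is kept, which suffices for the identity theorem
    above. *)
Definition branch_at (h : C -> C) (t : C) : Prop :=
  [/\ h s @[s --> t] --> h t, h t != 0 & leval L (h t) = t].

Section Relation.
Variables (I : finType) (M : laurent R) (a : I -> C) (h : I -> C -> C).
Variables (D : {poly C}) (V : set C).
Hypothesis Vo : open V.
Hypothesis hV : forall i t, V t -> branch_at (h i) t.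

Let Phi (t : C) : C := \sum_(i <- index_enum I) a i * leval M (h i t) - D.[t].

Let PhiP t : branch_relation M a h D t <-> \forall z \near t, Phi z = 0.
Proof.
by split; apply: filterS => z; rewrite /Phi; [move=> ->; rewrite subrr|move=> /eqP; rewrite subr_eq0 => /eqP].
Qed.

Let Phic t : V t -> Phi s @[s --> t] --> Phi t.
Proof.
move=> Vt; have h1 : \sum_(i <- index_enum I) a i * leval M (h i s) @[s --> t] -->
    \sum_(i <- index_enum I) a i * leval M (h i t).
  apply: (@cvg_sum_comp R C (nbhs t) (nbhs_filter t)) => i.
  have [hc h0 _] := hV i Vt.
  have Mc : leval M s @[s --> h i t] --> leval M (h i t).
    exact/differentiable_continuous/derivable1_diffP/derivable_leval.
  have Mh : leval M (h i s) @[s --> t] --> leval M (h i t).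
    exact: (cvg_comp _ _ hc Mc).
  exact: (cvgM (cvg_cst (a i)) Mh).
exact: (cvgB h1 (@cvg_horner_at R D t)).
Qed.

Let Phi_integral : exists2 g, integral_fun g & forall t, V t -> g t = Phi t.
Proof.
have /choice[g gP] : forall i, exists g, integral_fun g /\
    forall t, V t -> g t = leval M (h i t).
  move=> i; have [|g gi gE] := @integral_leval M V (h i).
    by move=> t Vt; have [_ h0 hE] := hV i Vt.
  by exists g.
exists (fun t => \sum_(i <- index_enum I) a i * g i t + poly_fun (- D) t).
  apply: integral_funD; last exact: integral_poly_fun.
  apply: integral_fun_sum => i _; apply: integral_funM; first exact: integral_cst.
  by have [] := gP i.
move=> t Vt; rewrite /Phi /poly_fun hornerN; congr (_ - _).
by apply: eq_bigr => i _; have [_ ->] := gP i.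
Qed.

Lemma branch_relation_locally_constant t : V t ->
  \forall s \near t, branch_relation M a h D s <-> branch_relation M a h D t.
Proof.
move=> Vt; have [g gi gE] := Phi_integral.
have := integral_identity_local Vo Phic gi gE Vt.
by apply: filterS => s st; rewrite !PhiP.
Qed.

Lemma branch_relation_connected t1 t2 : connected V -> V t1 -> V t2 ->
  branch_relation M a h D t1 -> branch_relation M a h D t2.
Proof.
move=> Vc Vt1 Vt2; rewrite !PhiP; have [g gi gE] := Phi_integral.
exact: (integral_identity Vo Phic gi gE Vc Vt1 Vt2).
Qed.

End Relation.

(** The polynomial [(q(z) - q(w)) / (z - w)], which remains meaningful and continuous at [z = w]. *)
Definition divided_diff (q : {poly C}) (z w : C) : C :=
  \sum_(k < size q) q`_k * \sum_(i < k) z ^+ (k.-1 - i) * w ^+ i.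

Lemma divided_diffE (q : {poly C}) (z w : C) :
  q.[z] - q.[w] = (z - w) * divided_diff q z w.
Proof.
rewrite !horner_coef -sumrB /divided_diff mulr_sumr; apply: eq_bigr => k _.
by rewrite -mulrBr subrXX mulrCA.
Qed.

Lemma divided_diff_diag (q : {poly C}) (z : C) : divided_diff q z z = q^`().[z].
Proof.
have [->|q0] := eqVneq q 0.
  by rewrite /divided_diff size_poly0 big_ord0 derivC horner0.
have sz : (size q^`() <= (size q).-1)%N.
  apply/leq_sizeP => i iq; rewrite coef_deriv nth_default ?mul0rn//.
  by apply: leq_trans (leqSpred _) _; rewrite ltnS.
have q1 : (0 < size q)%N by rewrite size_poly_gt0.
rewrite (horner_coef_wide _ sz) /divided_diff.
case: (size q) q1 {sz} => // m _; rewrite big_ord_recl big_ord0 mulr0 add0r.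
apply: eq_bigr => k _; rewrite coef_deriv lift0 mulrnAl -mulrnAr; congr (_ * _).
rewrite -[in RHS](card_ord k.+1) -sumr_const; apply: eq_bigr => i _.
by rewrite -exprD /= subnK // -ltnS.
Qed.

Lemma cvg_divided_diff (q : {poly C}) (f1 f2 : C -> C) (t : C) :
  f1 s @[s --> t] --> f1 t -> f2 s @[s --> t] --> f2 t ->
  divided_diff q (f1 s) (f2 s) @[s --> t] --> divided_diff q (f1 t) (f2 t).
Proof.
move=> c1 c2; apply: (@cvg_sum_comp R C (nbhs t) (nbhs_filter t)) => k.
have h : \sum_(i <- index_enum 'I_k) f1 s ^+ (k.-1 - i) * f2 s ^+ i @[s --> t] -->
    \sum_(i <- index_enum 'I_k) f1 t ^+ (k.-1 - i) * f2 t ^+ i.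
  apply: (@cvg_sum_comp R C (nbhs t) (nbhs_filter t)) => i.
  exact: (cvgM (cvg_exp_comp _ (n := (k.-1 - i)%N) c1) (cvg_exp_comp _ (n := i) c2)).
exact: (cvgM (cvg_cst (q`_k : C)) h).
Qed.

(** Agreement of two branches is an open condition: [f1 - f2] times the divided difference [W] of
    [p - t X^n] is 0. Where the branches meet, [W] is the derivative of a simple root, hence nonzero
    nearby. *)
Lemma branches_distinct (U : set C) (f1 f2 : C -> C) : open U -> connected U ->
  U `&` branch_points L = set0 ->
  (forall t, U t -> branch_at f1 t) -> (forall t, U t -> branch_at f2 t) ->
  (exists2 t, U t & f1 t != f2 t) -> forall t, U t -> f1 t != f2 t.
Proof.
move=> Uo Uc Ub b1 b2 [t0 Ut0 /eqP f0] t Ut; apply/eqP => ft; apply: f0.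
apply: (connected_locally_constant (P := [set t | f1 t = f2 t]) Uc _ Ut Ut0 ft) => {}t {ft} {}Ut.
apply: cvg_within.
have [c1 z1 e1] := b1 _ Ut; have [c2 z2 e2] := b2 _ Ut.
have Unear : \forall s \near t, U s by apply: open_nbhs_nbhs; split; [exact: Uo|exact: Ut].
have [ft|/eqP ft] := eqVneq (f1 t) (f2 t); last first.
  have h : f1 s - f2 s @[s --> t] --> f1 t - f2 t by exact: (cvgB c1 c2).
  have d0 : f1 t - f2 t != 0 by rewrite subr_eq0; exact/eqP.
  have := cvg_near_neq0 h d0; apply: filterS => s; rewrite subr_eq0 => /eqP fs.
  by split.
pose W s := divided_diff p (f1 s) (f2 s) - s * divided_diff 'X^n (f1 s) (f2 s).
have Wc : W s @[s --> t] --> W t.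
  have idc : (s : C) @[s --> t] --> t by exact: cvg_id.
  exact: (cvgB (cvg_divided_diff c1 c2) (cvgM idc (cvg_divided_diff c1 c2))).
have W0 : W t != 0.
  rewrite /W -ft !divided_diff_diag derivXn hornerMn hornerXn -[X in _ - X * _]e1.
  rewrite deriv_fiber// mulf_neq0 ?expf_neq0//; apply/eqP => d0.
  have : (U `&` branch_points L) t by split=> //; exists (f1 t).
  by rewrite Ub.
have := cvg_near_neq0 Wc W0; move: Unear; apply: filterS2 => s Us Ws.
split=> // _; have [_ z1' e1'] := b1 _ Us; have [_ z2' e2'] := b2 _ Us.
have p1 : p.[f1 s] = s * f1 s ^+ n by apply/leval_eqP.
have p2 : p.[f2 s] = s * f2 s ^+ n by apply/leval_eqP.
have : (f1 s - f2 s) * W s = 0.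
  rewrite mulrBr -divided_diffE mulrCA -divided_diffE !hornerXn p1 p2.
  by rewrite mulrBr subrr.
by move/eqP; rewrite mulf_eq0 (negPf Ws) orbF subr_eq0 => /eqP.
Qed.

End ProperLaurent.

(** * Invariant subspaces of the permutation representation *)

(** Take a subspace of maximal dimension contained in [P]; a vector of [P] outside it would enlarge
    it. *)
Lemma linear_pred_vspace (K : fieldType) (V : vectType K) (P : V -> Prop) :
  P 0 -> (forall c a b, P a -> P b -> P (c *: a + b)) ->
  exists W : {vspace V}, forall a, a \in W <-> P a.
Proof.
move=> P0 PD.
pose Q d := `[< exists2 W : {vspace V}, \dim W = d & forall a, a \in W -> P a >].
have Q0 : exists d, Q d.
  exists 0%N; apply/asboolP; exists 0%VS; first exact: dimv0.
  by move=> a; rewrite memv0 => /eqP ->.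
have Qle d : Q d -> (d <= \dim (fullv : {vspace V}))%N.
  by move=> /asboolP[W <- _]; exact/dimvS/subvf.
case: (ex_maxnP Q0 Qle) => d /asboolP[W Wd WP] dmax.
exists W => a; split=> [|Pa]; first exact: WP.
apply/negPn/negP => aW.
have : Q (\dim (W + <[a]>)).
  apply/asboolP; exists (W + <[a]>)%VS => // b /memv_addP[w wW [v /vlineP[c ->] ->]].
  by rewrite addrC; apply: PD => //; exact: WP.
move=> /dmax dW; have /eqP WE : W == (W + <[a]>)%VS by rewrite eqEdim addvSl Wd.
by case/negP: aW; rewrite WE; apply: (subvP (addvSr W <[a]>)); exact: memv_line.
Qed.

Section InvariantSubspace.
Variable r : nat.
Local Notation V := 'rV[rat]_r.

Definition indicator_row (S : {set 'I_r}) : V := \row_i (i \in S)%:R.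

Variables (G : {set 'S_r}) (W : {vspace V}) (S : {set 'I_r}).
Hypothesis GW : invariant_subspace G W.
Hypothesis SW : indicator_row S \in W.
Hypotheses (S0 : (0 < #|S|)%N) (Sr : (#|S| < r)%N).

Let not_full : ~~ ([set: 'I_r]%SET \subset S).
Proof.
by apply: contraL Sr => /subset_leq_card; rewrite cardsT card_ord -leqNgt.
Qed.

(** The indicator of [S] is nonzero, is not constant, and has nonzero coordinate sum, which excludes
    the three proper cases. *)
Lemma only_trivial_full : only_trivial_invariant_subspaces G -> W = fullv.
Proof.
move=> /(_ W GW); have [i iS] := card_gt0P S0.
have /subsetPn[k _ kS] := not_full.
case=> // WE; move: SW; rewrite WE.
- rewrite memv0 => /eqP /rowP /(_ i); rewrite !mxE iS => /eqP.
  by rewrite oner_eq0.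
- move=> /vlineP[c /rowP e]; have := e i; have := e k.
  rewrite !mxE iS (negPf kS) mulr1 => <- /eqP.
  by rewrite oner_eq0.
- rewrite memv_ker lfunE /= => /eqP /matrixP /(_ 0 0); rewrite !mxE.
  rewrite (eq_bigr (fun j => (j \in S)%:R)) => [|j _]; last by rewrite !mxE mulr1.
  rewrite -natr_sum (_ : (\sum_j (j \in S))%N = #|S|); last first.
    by rewrite -sum1_card [RHS]big_mkcond; apply: eq_bigr => j _; case: (j \in S).
  move=> /eqP; rewrite pnatr_eq0.
  by rewrite gtn_eqF.
Qed.

(** [G] is only a set, while the averaging below needs a group; the permutations preserving [W] form
    one that contains [G]. *)
Let stabilizer : exists H : {group 'S_r}, forall g,
  g \in H <-> (forall a, a \in W -> col_perm g a \in W).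
Proof.
pose H : {set 'S_r} := [set g | `[< forall a, a \in W -> col_perm g a \in W >]]%SET.
have HP g : g \in H <-> (forall a, a \in W -> col_perm g a \in W).
  by rewrite inE; split=> /asboolP.
suff gH : group_set H by exists (Group gH).
apply/group_setP; split=> [|g h]; first by apply/HP => a; rewrite col_perm1.
by move=> /HP gH /HP hH; apply/HP => a aW; rewrite col_permM; exact/gH/hH.
Qed.

(** Fix [i] in [S] and [k] outside. Summing the translates of the indicator over the [g] with
    [g x = i] gives a vector [u x] of [W] with one value at [x] and, by double transitivity, another
    common value elsewhere. The identity permutation separates the two values, so [u x - u y] is a
    nonzero multiple of [e x - e y] when [x != y]. *)
Lemma two_transitive_full :
  [transitive^2 G, on [set: 'I_r]%SET | 'P] -> W = fullv.
Proof.
move=> Gt; have [HG HGP] := stabilizer.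
have GH g : g \in G -> g \in HG by move=> gG; apply/HGP; exact: GW.
have Ht (x y a b : 'I_r) : x != y -> a != b -> exists2 h, h \in HG & h x = a /\ h y = b.
  move=> xy ab; move: Gt => /imsetP[t0 _ tE].
  have get (x' y' : 'I_r) : x' != y' ->
      exists2 g, g \in G & g (tnth t0 0) = x' /\ g (tnth t0 1) = y'.
    move=> xy'; have : [tuple x'; y'] \in dtuple_on 2 [set: 'I_r]%SET.
      by rewrite inE /= inE xy' /=; apply/fintype.subsetP => w _; rewrite finset.in_setT.
    rewrite tE => /imsetP[g gG e]; exists g => //.
    have := congr1 (fun t => tnth t 0) e; have := congr1 (fun t => tnth t 1) e.
    by rewrite !tnth_map /= !apermE => <- <-.
  have [g1 g1G [<- <-]] := get x y xy; have [g2 g2G [<- <-]] := get a b ab.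
  exists (g1^-1 * g2)%g; first by rewrite groupM ?groupV ?GH.
  by rewrite !permM !permK.
have [i iS] := card_gt0P S0.
have /subsetPn[k _ kS] := not_full.
have ik : i != k by apply: contraNneq kS => <-.
pose c x j := #|[set g in HG | (g x == i) && (g j \in S)]%SET|.
have cH h x j : h \in HG -> c (h x) (h j) = c x j.
  move=> hH; rewrite /c -[LHS](card_imset _ (mulgI h)); apply: eq_card => g.
  rewrite -[g in LHS](mulKVg h) mem_imset; last exact: mulgI.
  by rewrite !finset.in_set groupMl ?groupV// !permM !permK.
have c_ne x y : x != y -> c x y = c i k.
  by move=> xy; have [h hH [<- <-]] := Ht i k x y ik xy; rewrite cH.
have c_eq x : c x x = c i i.
  have [->//|xi] := eqVneq x i.
  have ix : i != x by rewrite eq_sym.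
  by have [h hH [<- _]] := Ht i x x i ix xi; rewrite cH.
have clt : (c i k < c i i)%N.
  apply: proper_card; apply/properP; split.
    by apply/fintype.subsetP => g; rewrite !finset.in_set => /andP[-> /andP[/eqP -> _]]; rewrite eqxx iS.
  exists 1%g; first by rewrite !finset.in_set group1 perm1 eqxx iS.
  by rewrite !finset.in_set !perm1 (negPf kS) !andbF.
pose u x := \sum_(g in HG | g x == i) col_perm g (indicator_row S).
have uW x : u x \in W.
  by apply: memv_suml => g /andP[/HGP gH _]; exact: gH.
have uE x j : u x 0 j = (c x j)%:R.
  rewrite /u summxE (eq_bigr (fun g : 'S_r => (g j \in S)%:R)) => [|g _]; last by rewrite !mxE.
  rewrite -natr_sum /c -sum1dep_card; congr (_%:R).
  rewrite [RHS]big_mkcond [LHS]big_mkcond; apply: eq_bigr => g _.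
  by case: (g \in HG) => //=; case: (g x == i) => //=; case: (g j \in S).
pose e x : V := delta_mx 0 x.
have eW x y : e x - e y \in W.
  have [->|xy] := eqVneq x y; first by rewrite subrr mem0v.
  have d0 : (c i i)%:R - (c i k)%:R != 0 :> rat by rewrite subr_eq0 eqr_nat gtn_eqF.
  have -> : e x - e y = ((c i i)%:R - (c i k)%:R)^-1 *: (u x - u y).
    apply/rowP => j; rewrite !mxE !uE /= [j == x]eq_sym [j == y]eq_sym.
    have [<-|xj] := eqVneq x j.
      have yx : y != x by rewrite eq_sym.
      by rewrite (negPf yx) c_eq (c_ne _ _ yx) subr0 mulVf.
    have [<-|yj] := eqVneq y j.
      by rewrite c_eq (c_ne _ _ xy) -[X in _ * X]opprB mulrN mulVf// sub0r.
    by rewrite (c_ne _ _ xj) (c_ne _ _ yj) !subrr mulr0.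
  by rewrite memvZ// memvB.
have SE x : (#|S|)%:R *: e x = \sum_(s in S) (e x - e s) + indicator_row S.
  have -> : indicator_row S = \sum_(s in S) e s.
    apply/rowP => j; rewrite mxE summxE; under eq_bigr do rewrite mxE /= eq_sym.
    rewrite big_mkcond (bigD1 j)//= eqxx big1 ?addr0 => [|s /negPf ->].
      by case: (j \in S).
    by case: ifP.
  by rewrite sumrB subrK sumr_const scaler_nat.
have ex x : e x \in W.
  have n0 : (#|S|)%:R != 0 :> rat by rewrite pnatr_eq0 -lt0n.
  have -> : e x = (#|S|)%:R^-1 *: (#|S|%:R *: e x) by rewrite scalerA mulVf// scale1r.
  by rewrite memvZ// SE memvD// memv_suml.
apply/vspaceP => a; rewrite memvf (row_sum_delta a).
by apply: memv_suml => j _; rewrite memvZ.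
Qed.

End InvariantSubspace.

(** * Continuation of relations along paths, fibers given by branches, and principal parts *)

Section BranchFibers.
Variable R : realType.
Local Notation C := (cplx R).
Local Notation I01 := (`[0, 1]%classic : set R).
Variable L : laurent R.
Hypothesis hL : lproper L.
Local Notation p := (lnumer L).
Local Notation n := (pole_order0 L).
Local Notation r := (ldegree L).

Lemma branch_relation_ext (M : laurent R) (a : 'I_r -> C) (D : {poly C})
    (f1 f2 : 'I_r -> C -> C) (t : C) :
  (forall i, \forall z \near t, f1 i z = f2 i z) ->
  branch_relation M a f1 D t -> branch_relation M a f2 D t.
Proof.
move=> f12; have : \forall z \near t, forall i, f1 i z = f2 i z.
  exact: (@filter_forall _ _ _ (nbhs t) _ f12).
by rewrite /branch_relation; apply: filterS2 => z kz <-; apply: eq_bigr => i _; rewrite kz.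
Qed.

Lemma derivable_branch_at (h : C -> C) (t : C) :
  derivable h t 1 -> h t != 0 -> leval L (h t) = t -> branch_at L h t.
Proof.
move=> hd h0 hE; split; [|exact: h0|exact: hE].
exact/differentiable_continuous/derivable1_diffP.
Qed.

(** Validity at the parameter [s] is locally constant on [[0, 1]]: the identity theorem moves the
    base point with the function elements fixed, then the neighbouring elements agree with these. *)
Lemma branch_relation_continuation (M : laurent R) (a : 'I_r -> C) (D : {poly C})
    (g : R -> C) (f1 f2 : 'I_r -> C -> C) :
  {within I01, continuous g} ->
  (forall i, analytic_continuation L g (f1 i) (f2 i)) ->
  branch_relation M a f1 D (g 0) -> branch_relation M a f2 D (g 1).
Proof.
move=> /subspace_continuousP gc /choice[h hP] rel0.
have I0 : I01 0 by rewrite /= in_itv /= lexx ler01.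
have I1 : I01 1 by rewrite /= in_itv /= lexx ler01.
pose P := [set s : R | branch_relation M a (fun i => h i s) D (g s)].
have P0 : P 0.
  apply: branch_relation_ext rel0 => i; have [h0 _ _] := hP i.
  by move: h0; apply: filterS => z ->.
suff : P 1 by apply: branch_relation_ext => i; have [_ h1 _] := hP i.
apply: (connected_locally_constant (P := P) (@segment_connected R 0 1) _ I0 I1 P0) => s Is.
have hd i : \forall z \near g s, branch_at L (h i s) z.
  have [_ _ /(_ s Is)[hd _]] := hP i.
  by move: hd; apply: filterS => z [? ? ?]; exact: derivable_branch_at.
have hn i : \forall s' \near within I01 (nbhs s), \forall z \near g s', h i s' z = h i s z.
  by have [_ _ /(_ s Is)[_ ?]] := hP i.
pose V := [set t | forall i, branch_at L (h i s) t]^°.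
have hd' : \forall z \near g s, forall i, branch_at L (h i s) z.
  exact: (@filter_forall _ _ _ (nbhs (g s)) _ hd).
have Vs : V (g s) := hd'.
have VP i t : V t -> branch_at L (h i s) t by move=> /interior_subset; exact.
have loc := branch_relation_locally_constant hL M a D (open_interior _) VP Vs.
have gs : \forall s' \near within I01 (nbhs s),
    branch_relation M a (fun i => h i s) D (g s') <->
    branch_relation M a (fun i => h i s) D (g s) := gc s Is _ loc.
have hn' : \forall s' \near within I01 (nbhs s), forall i, \forall z \near g s', h i s' z = h i s z.
  exact: (@filter_forall _ _ _ (within I01 (nbhs s)) _ hn).
move: gs hn'; apply: filterS2 => s' rel hs'; rewrite /P /= -rel; split.
  by apply: branch_relation_ext.
apply: branch_relation_ext => i; have := hs' i; apply: filterS => z; exact: esym.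
Qed.

Lemma fiber_branches (f : 'I_r -> C -> C) (t : C) :
  (forall i, branch_at L (f i) t) -> (forall i j, i != j -> f i t != f j t) ->
  fiber_list p n t [seq f i t | i <- enum 'I_r].
Proof.
move=> fb fd; have n_lt := lproper_pole_lt hL; rewrite /fiber_list.
rewrite -(lead_coef_fiber_poly n_lt t); apply: all_roots_prod_XsubC.
- rewrite (size_fiber_poly n_lt) size_map size_enum_ord (ldegree_lproper hL) prednK//.
  by case: (size p) n_lt.
- apply/allP => x /mapP[i _ ->]; have [_ f0 fE] := fb i.
  have := fE; rewrite (leval_eqP L _ f0) /root => e.
  by rewrite hornerD hornerN hornerZ hornerXn e subrr.
- rewrite uniq_rootsE map_inj_in_uniq ?enum_uniq// => i j _ _ fij.
  by apply/eqP; apply: contraT => /fd; rewrite fij eqxx.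
Qed.

Lemma fsfun_restrict_sum (P : pred int) (M N : laurent R) (x : C) :
  (forall k, N k = if P k then M k else 0) ->
  leval N x = \sum_(k <- finsupp M) (if P k then M k else 0) * x ^ k.
Proof.
move=> NE; rewrite /leval.
have sub : (finsupp N `<=` finsupp M)%fset.
  apply/fsubsetP => k; rewrite !mem_finsupp NE; case: (P k) => //.
  by rewrite eqxx.
under [RHS]eq_bigr do rewrite -NE.
by apply: big_fset_incl => // k _; rewrite mem_finsupp negbK => /eqP ->; rewrite mul0r.
Qed.

Lemma principal0E (M : laurent R) k : principal0 M k = if k < 0 then M k else 0.
Proof.
rewrite fsfunE; case: ifPn => // /fsfun_dflt ->.
by case: ifP.
Qed.

Lemma principalooE (M : laurent R) k : principaloo M k = if ~~ (k < 0) then M k else 0.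
Proof.
rewrite fsfunE; case: ifPn => [_|/fsfun_dflt ->]; last by case: ifP.
by case: (k < 0).
Qed.

Lemma leval_principal (M : laurent R) (x : C) :
  leval M x = leval (principaloo M) x + leval (principal0 M) x.
Proof.
rewrite (fsfun_restrict_sum x (principal0E M)) (fsfun_restrict_sum x (principalooE M)).
rewrite [LHS]/leval -big_split; apply: eq_bigr => k _ /=; rewrite -mulrDl.
by case: (k < 0); rewrite ?add0r ?addr0.
Qed.

Lemma weightE (M : laurent R) (x : C) : weight M x =
  if `|x| < 1 then leval (principaloo M) x else - leval (principal0 M) x.
Proof.
rewrite (fsfun_restrict_sum x (principal0E M)) (fsfun_restrict_sum x (principalooE M)).
rewrite /weight /root_weight; case: ifP => _; rewrite -?sumrN; apply: eq_bigr => k _.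
  by rewrite leNgt; case: (k < 0); rewrite ?mulr0 ?mul0r.
by rewrite leNgt; case: (k < 0); rewrite ?mulr0 ?mul0r ?oppr0 ?mulrN.
Qed.

Lemma principaloo_at0 (M : laurent R) : leval (principaloo M) 0 = M 0.
Proof.
have -> : M 0 = principaloo M 0 by rewrite principalooE ltxx.
rewrite /leval; have [i|/fsfun_dflt M0] := boolP (0 \in finsupp (principaloo M)).
  rewrite (big_rem (0 : int))//= mulr1 big_seq big1 ?addr0// => k.
  rewrite (rem_filter _ (fset_uniq _)) mem_filter => /andP[/= k0 _].
  by rewrite exp0rz (negPf k0) mulr0.
rewrite M0 big1_seq// => k /andP[_ kM]; rewrite exp0rz.
by case: eqP kM => [->|_ _]; rewrite ?mulr0// mem_finsupp M0 eqxx.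
Qed.

(** [M_0] is a polynomial in [1 / x], so its fiber sum is a combination of power sums of inverse
    roots. *)
Lemma principal0_power_sum (M : laurent R) : exists D : {poly C},
  forall t xs, fiber_list p n t xs -> \sum_(x <- xs) leval (principal0 M) x = D.[t].
Proof.
have n_gt0 := lproper_pole_gt0 hL; have p0 := lproper_numer0 hL.
have l0 := lead_coef_neq0 (lproper_pole_lt hL).
have /choice[D DE] k := fiber_power_sum_inv k n_gt0 p0.
exists (\sum_(k <- finsupp M) (if k < 0 then M k else 0) *: D `|k|.-1%N).
move=> t xs e; rewrite horner_sum.
under eq_bigr do rewrite (fsfun_restrict_sum _ (principal0E M)).
rewrite exchange_big; apply: eq_bigr => k _; rewrite hornerZ -mulr_sumr.
have [k0|] := ltP k 0; last by rewrite !mul0r.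
congr (_ * _); rewrite -(DE _ t _ xs l0 e); apply: eq_bigr => x _.
by case: k k0 => // m _; rewrite exprVn.
Qed.

Lemma unbounded_large (U : set C) (A : C) : unbounded_set U -> A \is Num.real ->
  exists2 t, U t & A < `|t|.
Proof. by move=> Uu /complex_realP[k ->]; exact: Uu. Qed.

Lemma poly_vanishing_at_infinity (q : {poly C}) (A B : C) :
  0 <= A -> B \is Num.real ->
  (forall t, B < `|t| -> `|q.[t]| <= A / `|t|) -> q = 0.
Proof.
move=> A0 Br qA; apply/eqP; apply/negPn/negP => q0.
have [rs qE] := closed_field_poly_normal q.
have l0 : lead_coef q != 0 by rewrite lead_coef_eq0.
have [b bE] := complex_realP _ Br.
pose s := \sum_(x <- rs) `|x|.
have s0 : 0 <= s by apply: sumr_ge0.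
(* This point lies beyond [B], at distance at least 1 from every root, so that [|q.[t]| >=
   |lead_coef q|], and beyond [A / |lead_coef q|]. *)
pose t := `|B| + 1 + s + A / `|lead_coef q|.
have lq : 0 < `|lead_coef q| by rewrite normr_gt0.
have t0 : 0 < t by rewrite ltr_wpDr ?divr_ge0// ltr_wpDr// ltr_wpDl.
have tE : `|t| = t by rewrite gtr0_norm.
have Bt : B < `|t|.
  rewrite tE /t -!addrA; apply: le_lt_trans (real_ler_norm Br) _.
  by rewrite ltrDl ltr_wpDr ?addr_ge0 ?divr_ge0 ?ltr01.
have st : 1 + s <= `|t|.
  have -> : `|t| = 1 + s + (`|B| + A / `|lead_coef q|).
    by rewrite tE /t; move: (A / _) => a'; ring.
  by rewrite lerDl addr_ge0 ?divr_ge0.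
have prod1 : 1 <= `|(\prod_(x <- rs) ('X - x%:P)).[t]|.
  have rs1 x : x \in rs -> 1 <= `|t - x|.
    move=> xrs; apply: le_trans (lerB_dist _ _); rewrite lerBrDr.
    by apply: le_trans st; rewrite lerD2l /s (big_rem x)//= lerDl sumr_ge0.
  move: rs1; rewrite horner_prod normr_prod; elim: (rs) => [|x l IH] rs1.
    by rewrite big_nil.
  rewrite big_cons hornerXsubC; apply: (@le_trans _ _ (1 * 1)); first by rewrite mulr1.
  apply: ler_pM => //; first by apply: rs1; rewrite mem_head.
  by apply: IH => y yl; apply: rs1; rewrite in_cons yl orbT.
have qt := qA t Bt; rewrite {1}qE hornerZ normrM in qt.
have := le_trans (ler_peMr (normr_ge0 (lead_coef q)) prod1) qt.
rewrite ler_pdivlMr ?tE// => tA.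
have : A / `|lead_coef q| < t.
  by rewrite /t ltrDr ltr_wpDr// ltr_wpDl.
rewrite ltr_pdivrMr// mulrC => /lt_le_trans /(_ tA).
by rewrite ltxx.
Qed.

End BranchFibers.

(** * Moments and fiber sums *)

Section Moments0.
Variable R : realType.
Local Notation C := (cplx R).
Variables L M : laurent R.
Hypothesis hL : lproper L.
Hypothesis M0 : M 0 = 0.
Local Notation p := (lnumer L).
Local Notation n := (pole_order0 L).
Let n_gt0 := lproper_pole_gt0 hL.
Let n_lt := lproper_pole_lt hL.
Let p0 := lproper_numer0 hL.

Lemma moment_eq0 i : moment L M i = 0 <-> moment_coef p n M i = 0.
Proof.
rewrite momentE; split=> [/eqP|->]; last by rewrite mulr0.
rewrite mulf_eq0 => /orP[|/eqP//]; rewrite mulf_eq0 => /orP[] /eqP e; exfalso.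
  have : 2 * pi = 0 :> R by have := congr1 (@complex.Re R) e.
  by apply/eqP; rewrite mulf_neq0// gt_eqF// pi_gt0.
by have /eqP := congr1 (@complex.Im R) e; rewrite /= oner_eq0.
Qed.

(** The derivative [M'] has no term in [1 / z]. *)
Lemma moment0 : moment L M 0 = 0.
Proof.
apply/moment_eq0; rewrite /moment_coef big1// => k _.
rewrite /lcoef muln0 addr0; case: ifP => _; last by rewrite !mulr0.
rewrite expr0 coef1; have [->|k0] := eqVneq k 0; first by rewrite mul0r mulr0.
by rewrite -[absz _ == 0%N]/(`|- k|%N == 0%N) absz_eq0 oppr_eq0 (negPf k0) !mulr0.
Qed.

Lemma moments_all0 i0 : (forall i, (i0 <= i)%N -> moment L M i = 0) ->
  forall i, moment L M i = 0.
Proof.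
move=> h [|i]; first exact: moment0.
apply/moment_eq0; apply: (@moment_coef_all0 _ _ _ n_gt0 n_lt p0 _ i0 M0) => j ij.
by apply/moment_eq0/h/(leq_trans ij).
Qed.

Lemma sum_weight_eq0 t xs : (forall i, moment L M i = 0) ->
  fiber_list p n t xs -> 2 * fiber_bound p < `|t| -> \sum_(x <- xs) weight M x = 0.
Proof.
move=> h e tB; have Mj j : (0 <= j)%N -> moment_coef p n M j.+1 = 0.
  by move=> _; apply/moment_eq0.
by rewrite (fiber_sum_weight_eventually0 n_gt0 n_lt p0 Mj e tB) big_ord0 addr0 M0 mulr0.
Qed.

Lemma moments_eq0 (T : set C) : unbounded_set T ->
  (forall t xs, T t -> fiber_list p n t xs -> 2 * fiber_bound p < `|t| ->
     \sum_(x <- xs) weight M x = 0) -> forall i, moment L M i = 0.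
Proof.
move=> Tu TP [|i]; first exact: moment0.
apply/moment_eq0; apply: (moment_coef_eq0 n_gt0 n_lt p0 Tu) => t xs Tt e tB.
by rewrite M0 mulr0; exact: TP Tt e tB.
Qed.

(** This rewrites [F] as the sum of [M] over the small roots minus the full fiber sum of [M_0], a
    polynomial in [t]. *)
Lemma weight_split x : weight M x =
  (if `|x| < 1 then leval M x else 0) - leval (principal0 M) x.
Proof.
rewrite weightE (leval_principal M); case: ifP => _; last by rewrite sub0r.
by rewrite addrK.
Qed.

Let fiber_bound_real : 2 * fiber_bound p \is Num.real.
Proof. by apply: gtr0_real; rewrite mulr_gt0 ?fiber_bound_gt0. Qed.

(** There are [n] small roots, each contributing [P(t)], so [F = n P - D] is a polynomial for large
    [t]. It is also [O(1 / t)], hence zero. *)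
Lemma moments_comp (P : {poly C}) :
  (forall z : C, z != 0 -> leval M z = P.[leval L z]) ->
  forall i, moment L M i = 0.
Proof.
move=> MP; have [D DE] := principal0_power_sum hL M.
have FE t xs : fiber_list p n t xs -> 2 * fiber_bound p < `|t| ->
    \sum_(x <- xs) weight M x = (n%:R *: P - D).[t].
  move=> e tB; under eq_bigr do rewrite weight_split.
  rewrite sumrB (DE _ _ e) hornerD hornerN hornerZ; congr (_ - _).
  rewrite -big_mkcond -(fiber_count_small n_gt0 n_lt p0 e tB) -sum1_count.
  rewrite natr_sum mulr_suml big_seq_cond [RHS]big_seq_cond.
  apply: eq_bigr => x /andP[xxs _]; have x0 := fiber_neq0 n_gt0 n_lt p0 e xxs.
  rewrite MP// mul1r; congr (_.[_]).
  by apply/(leval_eqP L t x0)/eqP; rewrite -(mem_fiber n_lt _ e).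
have [K K0 KP] := fiber_sum_weight n_gt0 n_lt p0 M.
have q0 : n%:R *: P - D = 0.
  apply: (@poly_vanishing_at_infinity R _
    (K * fiber_bound p + `|moment_coef p n M 1|) (2 * fiber_bound p)).
  - by rewrite addr_ge0// mulr_ge0// ltW ?fiber_bound_gt0.
  - exact: fiber_bound_real.
  move=> t tB; have [xs e] := fiber_list_exists n_lt t.
  have := KP t xs 1%N e tB; rewrite M0 mulr0 subr0 big_ord1 !expr1 (FE t xs e tB) divr1.
  set q := _.[t]; set m := moment_coef _ _ _ _ => h.
  have -> : q = (q - t^-1 * m) + t^-1 * m by rewrite subrK.
  apply: le_trans (ler_normD _ _) _.
  rewrite mulrDl; apply: lerD; first by rewrite -mulrA.
  by rewrite normrM normfV mulrC.
apply: (moments_eq0 (T := setT)) => [k|t xs _ e tB].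
  have [t _ tk] : exists2 t : C, True & k%:C%C < `|t|; last by exists t.
  exists (`|k| + 1)%:C%C => //.
  have -> : `|(`|k| + 1)%:C%C : C| = (`|k| + 1)%:C%C.
    by rewrite ger0_norm// (lecR 0) addr_ge0.
  by rewrite ltcR (le_lt_trans (ler_norm k))// ltrDl.
by rewrite (FE t xs e tB) q0 horner0.
Qed.

(** With denominators cleared, [M - D(L)] is a polynomial [q] vanishing at all [f t]. Were [q]
    nonzero, its finitely many roots would have a finite image under [L], yet this image contains
    every [t] near [t0]. *)
Lemma laurent_branch_identity (D : {poly C}) (f : C -> C) (t0 : C) :
  (\forall t \near t0, [/\ f t != 0, leval L (f t) = t & leval M (f t) = D.[t]]) ->
  forall z : C, z != 0 -> leval M z = D.[leval L z].
Proof.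
move=> fP.
pose lfun (F : C -> C) := exists N (q : {poly C}), forall z, z != 0 -> F z * z ^+ N = q.[z].
have lleval (N : laurent R) : lfun (leval N).
  exists (pole_order0 N), (lnumer N) => z z0.
  by rewrite lnumerE// divfK// expf_neq0.
have ladd F G : lfun F -> lfun G -> lfun (fun z => F z + G z).
  move=> [N1 [q1 h1]] [N2 [q2 h2]]; exists (N1 + N2)%N, (q1 * 'X^N2 + q2 * 'X^N1) => z z0.
  rewrite hornerD !hornerM !hornerXn -h1// -h2// exprD; ring.
have lmul F G : lfun F -> lfun G -> lfun (fun z => F z * G z).
  move=> [N1 [q1 h1]] [N2 [q2 h2]]; exists (N1 + N2)%N, (q1 * q2) => z z0.
  rewrite hornerM -h1// -h2// exprD; ring.
have lcst a : lfun (fun=> a) by exists 0%N, a%:P => z _; rewrite hornerC expr0 mulr1.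
have lext F G : F =1 G -> lfun F -> lfun G by move=> /funext ->.
have lcomp (P : {poly C}) : lfun (fun z => P.[leval L z]).
  elim/poly_ind: P => [|P c IH].
    by apply: lext (lcst 0) => z; rewrite horner0.
  apply: lext (ladd _ _ (lmul _ _ IH (lleval L)) (lcst c)) => z.
  by rewrite hornerD hornerM hornerX hornerC.
have [N [q qE]] := ladd _ _ (lleval M) (lmul _ _ (lcst (-1)) (lcomp D)).
suff q0 : q = 0.
  move=> z z0; have := qE z z0; rewrite q0 horner0 => /eqP.
  rewrite mulf_eq0 (negPf (expf_neq0 _ z0)) orbF mulN1r subr_eq0 => /eqP; exact.
apply/eqP; apply/negPn/negP => q0.
have [rs rsE] := closed_field_poly_normal q.
have l0 : lead_coef q != 0 by rewrite lead_coef_eq0.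
pose w := \prod_(x <- [seq leval L x | x <- rs]) ('X - x%:P).
have w0 : w != 0 by rewrite monic_neq0// monic_prod_XsubC.
have wr : \forall t \near t0, w.[t] = 0.
  move: fP; apply: filterS => t [f0 fL fM].
  have : f t \in rs.
    rewrite -root_prod_XsubC -(rootZ _ _ l0) -rsE /root -qE// fL fM mulN1r subrr mul0r.
    by [].
  by move=> /(map_f (leval L)); rewrite fL -root_prod_XsubC => /eqP.
have := near_poly_neq0 t0 w0 => wn.
have : \forall t \near t0, w.[t] = 0 /\ (t != t0 -> w.[t] != 0).
  by move: wr wn; apply: filterS2.
move=> /near_punctured_exists[t tt0 [wt /(_ tt0)]].
by rewrite wt eqxx.
Qed.

End Moments0.

Lemma near_norm_lt (R : realType) (w a : cplx R) :
  `|w| < a -> \forall z \near w, `|z| < a.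
Proof.
move=> wa; apply/nbhs_ballP; exists (a - `|w|); first by rewrite /= subr_gt0.
move=> z; rewrite -ball_normE /ball_ /= => wz; have -> : z = w - (w - z) by ring.
by apply: le_lt_trans (ler_normB _ _) _; rewrite addrC -ltrBrDr.
Qed.

Lemma near_norm_gt (R : realType) (w a : cplx R) :
  a < `|w| -> \forall z \near w, a < `|z|.
Proof.
move=> wa; apply/nbhs_ballP; exists (`|w| - a); first by rewrite /= subr_gt0.
move=> z; rewrite -ball_normE /ball_ /= => wz.
rewrite ltrBrDr addrC -ltrBrDr in wz; apply: lt_le_trans wz _.
by rewrite lerBlDr -{1}(subrK z w) addrC ler_normD.
Qed.

(** * The branches on [U]: sums near infinity and monodromy *)

Section BranchSums.
Variable R : realType.
Local Notation C := (cplx R).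
Variables L M : laurent R.
Hypothesis hL : lproper L.
Hypothesis M0 : M 0 = 0.
Local Notation p := (lnumer L).
Local Notation n := (pole_order0 L).
Local Notation r := (ldegree L).
Let n_gt0 := lproper_pole_gt0 hL.
Let n_lt := lproper_pole_lt hL.
Let p0 := lproper_numer0 hL.

Variables (U : set C) (f : 'I_r -> C -> C).
Hypothesis hU : simply_connected_domain U.
Hypothesis Uu : unbounded_set U.
Hypothesis Ub : U `&` branch_points L = set0.
Hypothesis hf : inverse_branches U f.

Let Uo : open U. Proof. by case: hU. Qed.
Let Uc : connected U. Proof. by case: hU. Qed.

Let fb i t : U t -> branch_at L (f i) t.
Proof.
move=> Ut; have [fd fE _] := hf; have [f0 fL] := fE i t Ut.
exact: derivable_branch_at (fd i t Ut) f0 fL.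
Qed.

Let fd i j t : i != j -> U t -> f i t != f j t.
Proof.
move=> ij; have [_ _ /(_ i j ij) h] := hf.
exact: (branches_distinct Uo Uc Ub (fb i) (fb j) h).
Qed.

Let ffiber t : U t -> fiber_list p n t [seq f i t | i <- enum 'I_r].
Proof.
move=> Ut; apply: (fiber_branches hL) => [i|i j ij]; first exact: fb.
exact: fd.
Qed.

Let sum_fiber (F : C -> C) t xs : U t -> fiber_list p n t xs ->
  \sum_(x <- xs) F x = \sum_i F (f i t).
Proof.
move=> Ut e; have e' := ffiber Ut.
have pxs : perm_eq xs [seq f i t | i <- enum 'I_r].
  apply: prod_XsubC_eq; have l0 := lead_coef_neq0 n_lt.
  by apply: (scalerI l0); rewrite -e -e'.
by rewrite (perm_big _ pxs) /= big_map big_enum.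
Qed.

(** Translates closeness to 0 or to infinity into the dichotomy [|x| < 1] on which [weight] is
    built. *)
Lemma large_branches : J0 U f :|: Joo U f = [set: 'I_r]%SET ->
  exists K : R, forall t, U t -> K%:C%C < `|t| ->
    forall i, (i \in J0 U f) = (`|f i t| < 1) /\ (i \in Joo U f) = ~~ (`|f i t| < 1).
Proof.
move=> JU; have /choice[K KP] : forall i, exists K : R, forall t, U t -> K%:C%C < `|t| ->
    ((i \in J0 U f) -> `|f i t| < 1) /\ ((i \in Joo U f) -> 1 < `|f i t|).
  move=> i.
  have [K1 K1P] : exists K : R, forall t, U t -> K%:C%C < `|t| -> (i \in J0 U f) -> `|f i t| < 1.
    have [|_] := boolP (i \in J0 U f); last by exists 0.
    rewrite inE => /asboolP h.
    have b1 : nbhs (0 : C) [set z : C | `|z| < 1].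
      apply/nbhs_ballP; exists 1; first exact: ltr01.
      by move=> z; rewrite -ball_normE /ball_ /= sub0r normrN.
    by have [K KP] := h _ b1; exists K => t Ut tK _; exact: KP.
  have [K2 K2P] : exists K : R, forall t, U t -> K%:C%C < `|t| -> (i \in Joo U f) -> 1 < `|f i t|.
    have [|_] := boolP (i \in Joo U f); last by exists 0.
    rewrite inE => /asboolP h.
    have b1 : cinfty_nbhs [set z : C | 1 < `|z|] by exists 1.
    by have [K KP] := h _ b1; exists K => t Ut tK _; exact: KP.
  exists (Num.max K1 K2) => t Ut tK; split.
    by apply: K1P => //; apply: le_lt_trans tK; rewrite lecR le_max lexx.
  by apply: K2P => //; apply: le_lt_trans tK; rewrite lecR le_max lexx orbT.
exists (\sum_i `|K i|) => t Ut tK i.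
have [h0 h1] : ((i \in J0 U f) -> `|f i t| < 1) /\ ((i \in Joo U f) -> 1 < `|f i t|).
  apply: KP => //; apply: le_lt_trans tK; rewrite lecR.
  apply: le_trans (ler_norm _) _; rewrite (bigD1 i)//= lerDl.
  by apply: sumr_ge0.
have : i \in J0 U f :|: Joo U f by rewrite JU finset.in_setT.
have [i0|i0] := boolP (i \in J0 U f).
  move=> _; rewrite h0//; split=> //; apply/negP => /h1 /(lt_trans (h0 i0)).
  by rewrite ltxx.
rewrite finset.in_setU (negPf i0) /= => ioo; rewrite ioo.
by have /lt_gtF -> := h1 ioo.
Qed.

Lemma moments_eq0_branch_sums i0 : J0 U f :|: Joo U f = [set: 'I_r]%SET ->
  (forall i, (i0 <= i)%N -> moment L M i = 0) <->
  \forall t \near within U cinfty_nbhs,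
     \sum_(i in J0 U f) leval (principaloo M) (f i t) =
     \sum_(i in Joo U f) leval (principal0 M) (f i t).
Proof.
move=> /large_branches[K KP].
have sumE t : U t -> K%:C%C < `|t| -> \sum_i weight M (f i t) =
    \sum_(i in J0 U f) leval (principaloo M) (f i t) -
    \sum_(i in Joo U f) leval (principal0 M) (f i t).
  move=> Ut tK; rewrite -sumrN [X in X + _]big_mkcond [X in _ + X]big_mkcond -big_split.
  apply: eq_bigr => i _ /=; have [-> ->] := KP t Ut tK i; rewrite weightE.
  by case: ifP => _ /=; rewrite ?addr0 ?add0r.
have [b bE] : exists b : R, 2 * fiber_bound p = b%:C%C.
  by apply/complex_realP; apply: gtr0_real; rewrite mulr_gt0 ?fiber_bound_gt0.
split=> [h|[K' K'P] i _].
  exists (Num.max b K) => t tK Ut.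
  have tK' : K%:C%C < `|t| by apply: le_lt_trans tK; rewrite lecR le_max lexx orbT.
  have tB : 2 * fiber_bound p < `|t|.
    by rewrite bE; apply: le_lt_trans tK; rewrite lecR le_max lexx.
  apply/eqP; rewrite -subr_eq0 -sumE// -(sum_fiber _ Ut (ffiber Ut)).
  by rewrite (sum_weight_eq0 hL M0 (moments_all0 hL M0 h) (ffiber Ut) tB).
(* The identity is known only inside [U], but an unbounded set determines the expansion. *)
pose T := [set t : C | [/\ U t, K%:C%C < `|t| & K'%:C%C < `|t|]].
apply: (@moments_eq0 _ _ _ hL M0 T) => [k|t xs [Ut tK tK'] e _].
  have [t Ut tk] := Uu (Num.max k (Num.max K K')).
  exists t; first split=> //; apply: le_lt_trans tk; rewrite lecR !le_max lexx ?orbT//.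
by rewrite (sum_fiber _ Ut e) sumE// K'P// subrr.
Qed.

(** [S] is fixed at one large [t1]. No root there lies on the unit circle, so [S] still marks the
    small branches near [t1]; the relation obtained there then spreads over [U], including points
    where size no longer tells the branches apart. *)
Lemma small_branches_relation : (forall i, moment L M i = 0) ->
  exists (S : {set 'I_r}) (D : {poly C}), #|S| = n /\
    forall t, U t -> branch_relation M (fun i => (i \in S)%:R) f D t.
Proof.
move=> h; have [D DE] := principal0_power_sum hL M.
have [t1 Ut1 tB] : exists2 t, U t & 2 * fiber_bound p < `|t|.
  apply: unbounded_large Uu _; apply: gtr0_real.
  by rewrite mulr_gt0 ?fiber_bound_gt0.
pose S : {set 'I_r} := [set i | `|f i t1| < 1]%SET.
exists S, D; split.
  rewrite -(fiber_count_small n_gt0 n_lt p0 (ffiber Ut1) tB) -sum1_count big_map.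
  by rewrite big_enum_cond /= -sum1_card; apply: eq_bigl => i; rewrite inE.
suff rel : branch_relation M (fun i => (i \in S)%:R) f D t1.
  move=> t Ut; apply: (branch_relation_connected hL Uo _ Uc Ut1 Ut rel).
  by move=> i s; exact: fb.
have Unear : \forall t \near t1, U t by apply: open_nbhs_nbhs; split; [exact: Uo|exact: Ut1].
have tnear : \forall t \near t1, 2 * fiber_bound p < `|t|.
  exact: near_norm_gt.
have fnear : \forall t \near t1, forall i, (`|f i t| < 1) = (i \in S).
  apply: (@filter_forall _ _ _ (nbhs t1) _) => i; have [fc _ _] := fb i Ut1.
  have fi : f i t1 \in [seq f i t1 | i <- enum 'I_r] by rewrite map_f// mem_enum.
  have f1 := fiber_not_unit_circle (ffiber Ut1) (fiber_bound_lt tB) fi.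
  rewrite inE; have [fs|fs] := boolP (`|f i t1| < 1).
    exact: (fc _ (near_norm_lt fs)).
  have fl : 1 < `|f i t1| by rewrite lt_neqAle eq_sym f1 real_leNgt ?normr_real.
  have : \forall t \near t1, 1 < `|f i t| := fc _ (near_norm_gt fl).
  by apply: filterS => t /lt_gtF.
rewrite /branch_relation.
have := @filterS3 _ (nbhs t1) _ _ _ _ _ _ Unear tnear fnear; apply => t Ut tB' ft.
have := sum_weight_eq0 hL M0 h (ffiber Ut) tB'.
under eq_bigr do rewrite weight_split.
rewrite sumrB (DE _ _ (ffiber Ut)) => /eqP; rewrite subr_eq0 => /eqP <-.
rewrite (sum_fiber _ Ut (ffiber Ut)); apply: eq_bigr => i _; rewrite ft.
by case: (i \in S); rewrite ?mul1r ?mul0r.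
Qed.

Lemma relation_subspace (t0 : C) : U t0 -> exists W : {vspace 'rV[rat]_r},
  forall a, a \in W <->
    exists D, branch_relation M (fun i => ratr (a 0 i)) f D t0.
Proof.
move=> Ut0; apply: linear_pred_vspace.
  exists 0; apply: (@filterE _ (nbhs t0)) => z; rewrite horner0 big1// => i _.
  by rewrite mxE rmorph0 mul0r.
move=> c a b [D1 r1] [D2 r2]; exists (ratr c *: D1 + D2).
have := @filterS2 _ (nbhs t0) _ _ _ _ _ r1 r2; apply => z e1 e2.
rewrite hornerD hornerZ -e1 -e2 mulr_sumr -big_split; apply: eq_bigr => i _ /=.
by rewrite !mxE rmorphD rmorphM /= mulrDl -[in LHS]mulrA.
Qed.

(** Continuation replaces [f i] by [f (g i)], so it acts on coefficient vectors through [g^-1];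
    since [g] has finite order, [g] itself is a power of [g^-1]. *)
Lemma relation_subspace_invariant (t0 : C) (W : {vspace 'rV[rat]_r}) :
  (forall a, a \in W <->
    exists D, branch_relation M (fun i => ratr (a 0 i)) f D t0) ->
  invariant_subspace (monodromy_group t0 f) W.
Proof.
move=> WP g; rewrite inE => /asboolP[c [cc _ c0 c1 cont]].
have WV a : a \in W -> col_perm g^-1%g a \in W.
  move=> /WP[D rel]; apply/WP; exists D.
  rewrite -c0 in rel; have := branch_relation_continuation hL cc cont rel.
  rewrite c1 /branch_relation; apply: filterS => z <-.
  rewrite [LHS](reindex_inj (@perm_inj _ g)) /=; apply: eq_bigr => i _.
  by rewrite mxE permK.
have WX k a : a \in W -> col_perm (g^-1 ^+ k)%g a \in W.
  move=> aW; elim: k => [|k IH]; first by rewrite expg0 col_perm1.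
  by rewrite expgS col_permM; exact: WV.
by move=> a aW; rewrite -[g]invgK invg_expg; exact: WX.
Qed.

Lemma moments_eq0_exists_comp (t0 : C) : U t0 ->
  [transitive^2 monodromy_group t0 f, on [set: 'I_r]%SET | 'P] \/
    only_trivial_invariant_subspaces (monodromy_group t0 f) ->
  (forall i, moment L M i = 0) ->
  exists P : {poly C}, forall z : C, z != 0 -> leval M z = P.[leval L z].
Proof.
move=> Ut0 Gt h; have [S [D [Sn rel]]] := small_branches_relation h.
have [W WP] := relation_subspace Ut0.
have GW := relation_subspace_invariant WP.
have SW : indicator_row S \in W.
  apply/WP; exists D; have := rel t0 Ut0; rewrite /branch_relation.
  apply: filterS => z <-; apply: eq_bigr => i _.
  by rewrite mxE ratr_nat.
have r_gt : (n < r)%N by rewrite (ldegree_lproper hL).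
have Wfull : W = fullv.
  have S0 : (0 < #|S|)%N by rewrite Sn.
  have Sr : (#|S| < r)%N by rewrite Sn.
  case: Gt; first exact: two_transitive_full GW SW S0 Sr.
  exact: only_trivial_full GW SW S0 Sr.
pose i : 'I_r := Ordinal (leq_ltn_trans (leq0n n) r_gt).
have /WP[P Prel] : (delta_mx 0 i : 'rV[rat]_r) \in W by rewrite Wfull memvf.
exists P; apply: (@laurent_branch_identity _ L M P (f i) t0).
have Unear : \forall t \near t0, U t by apply: open_nbhs_nbhs; split; [exact: Uo|exact: Ut0].
have := @filterS2 _ (nbhs t0) _ _ _ _ _ Unear Prel; apply => t Ut e.
have [_ f0 fL] := fb i Ut; split=> //.
rewrite -e (bigD1 i)//= big1 ?addr0 => [|j /negPf ji].
  by rewrite mxE !eqxx rmorph1 mul1r.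
by rewrite mxE ji andbF rmorph0 mul0r.
Qed.

End BranchSums.

Theorem theorem6p5 (R : realType) (L M : laurent R) (i0 : nat)
    (hL : lproper L) (hM : leval (principaloo M) 0 = 0) :
  [/\ (forall i, (i0 <= i)%N -> moment L M i = 0) ->
        forall i, moment L M i = 0,
      forall (U : set (cplx R)) (f : 'I_(ldegree L) -> cplx R -> cplx R),
        simply_connected_domain U -> unbounded_set U ->
        U `&` branch_points L = set0 -> inverse_branches U f ->
        J0 U f :|: Joo U f = [set: 'I_(ldegree L)]%SET ->
        ((forall i, (i0 <= i)%N -> moment L M i = 0) <->
         \forall t \near within U cinfty_nbhs,
           \sum_(i in J0 U f) leval (principaloo M) (f i t) =
           \sum_(i in Joo U f) leval (principal0 M) (f i t))
    & forall (U : set (cplx R)) (f : 'I_(ldegree L) -> cplx R -> cplx R)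
          (t0 : cplx R),
        simply_connected_domain U -> unbounded_set U ->
        U `&` branch_points L = set0 -> inverse_branches U f -> U t0 ->
        [transitive^2 monodromy_group t0 f, on [set: 'I_(ldegree L)]%SET | 'P] \/
        only_trivial_invariant_subspaces (monodromy_group t0 f) ->
        ((forall i, (i0 <= i)%N -> moment L M i = 0) <->
         exists P : {poly cplx R},
           forall z : cplx R, z != 0 -> leval M z = P.[leval L z])].
Proof.
(* The normalization of [M] says that its constant coefficient vanishes, which removes the constant
   [n * M 0] from the expansion of [F]. *)
have M0 : M 0 = 0 by rewrite -principaloo_at0.
split=> [h|U f hU Uu Ub hf JU|U f t0 hU Uu Ub hf Ut0 Gt].
- exact: moments_all0 hL M0 i0 h.
- exact: (moments_eq0_branch_sums hL M0 hU Uu Ub hf i0 JU).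
split=> [h|[P MP] i _]; last exact: (moments_comp hL M0 MP).
exact: (moments_eq0_exists_comp hL M0 hU Uu Ub hf Ut0 Gt (moments_all0 hL M0 h)).
Qed.
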